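(* Let $n\ge2$, let $\Phi$ be the root system of type $B_n$ with positive roots $\Phi^+=\{e_i\pm e_j\mid1\le i<j\le n\}\cup\{e_i\mid1\le i\le n\}$, and let $q$ be a power of a prime $p>2$. Let $\alpha=e_1+e_i$ with $1<i\le n$, and let $a(\alpha)$, $\ell(\alpha)$, $k(\alpha)$, $S_\alpha$, $\overline{S}_\alpha$, $\overline{T}_\alpha$, $b_{1,i}$, $\mathrm{ob}(\alpha)$ and $\mathrm{kob}(\alpha)$ be as in the context. Then: (a) $S_\alpha/P(\ell(\alpha)\cup k(\alpha))\cong\overline{S}_\alpha/\overline{P(\ell(\alpha))}\cong\overline{T}_\alpha\times X_\alpha$, where $\overline{P(\ell(\alpha))}$ is the image of $P(\ell(\alpha))P(k(\alpha))$ in $\overline{S}_\alpha$. (b) $\overline{T}_\alpha\cong P(b_{1,i})/P(b_{1,i}\cap k(\alpha))\ltimes P(\mathrm{ob}(\alpha))/P(\mathrm{ob}(\alpha)\cap k(\alpha))$. (c) If $i<n$ then $\mathrm{kob}(\alpha)$ is a pattern that is normal in $b_{1,i}$, and $P(\mathrm{kob}(\alpha))$ centralizes $P(\mathrm{ob}(\alpha))/P(\mathrm{ob}(\alpha)\cap k(\alpha))$. (d) If $i\in\{2,3\}$ then $\mathrm{kob}(\alpha)=b_{1,i}$, $k(\alpha)=n(\alpha)$ and $\overline{T}_\alpha\cong UB_{n-2}\times(UA_1)^{i-1}$. (e) If $i>3$ then $P(b_{1,i})/P(b_{1,i}\cap k(\alpha))$ is isomorphic to a quotient pattern group of $UB_{n-2}$.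 (f) If $i>3$ then $P(b_{1,i})/P(\mathrm{kob}(\alpha)\cup(k(\alpha)\cap b_{1,i}))\cong UA_{i-3}$.
   Context: $UB_n=UB_n(q)=\langle X_\gamma\mid\gamma\in\Phi^+\rangle$, where $X_\gamma$ are the root subgroups (isomorphic to $(\mathbb{F}_q,+)$) of the Chevalley group of type $B_n$ over $\mathbb{F}_q$; $UA_m=UA_m(q)$ is the analogous group of type $A_m$, i.e. the group of upper unitriangular $(m+1)\times(m+1)$ matrices over $\mathbb{F}_q$. By convention $UB_0=\{1\}$ and $UB_1\cong UA_1\cong(\mathbb{F}_q,+)$. A set $S\subseteq\Phi^+$ is a closed pattern (or pattern) if $\beta,\gamma\in S$, $\beta+\gamma\in\Phi^+$ imply $\beta+\gamma\in S$; $P(S)=\langle X_\gamma\mid\gamma\in S\rangle$. For $N\subseteq S$ with $S$ a closed pattern, $N$ is normal in $S$ ($N\unlhd S$) if $\beta\in N,\gamma\in S,\beta+\gamma\in\Phi^+$ imply $\beta+\gamma\in N$; then $P(S)/P(N)$ is called a quotient pattern group of $P(S)$. For $\alpha\in\Phi^+$: $n(\alpha)$ is the smallest normal subset of $\Phi^+$ containing $\alpha$, with $\alpha$ removed; $k(\alpha)$ is the largest $N\unlhd\Phi^+$ with $\alpha\notin N$. For $\alpha=e_1+e_i$: $a(\alpha)=\{e_i\}\cup\{e_i\pm e_s\mid i<s\le n\}\cup\{e_1-e_s\mid1<s<i\}$, $\ell(\alpha)=\{e_1\}\cup\{e_1\pm e_s\mid i<s\le n\}\cup\{e_s+e_i\mid1<s<i\}$,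 $s(\alpha)=\Phi^+\setminus a(\alpha)$, $S_\alpha=P(s(\alpha))$, $\overline{S}_\alpha=S_\alpha/P(k(\alpha))$, $\overline{T}_\alpha=S_\alpha/P(\{\alpha\}\cup\ell(\alpha)\cup k(\alpha))$. Further $b_{1,i}=\{e_t\mid t\notin\{1,i\}\}\cup\{e_r\pm e_s\mid r<s,\ r,s\notin\{1,i\}\}$, $\mathrm{ob}(\alpha)=\{e_r-e_i\mid1\le r<i\}$, and $\mathrm{kob}(\alpha)=b_{1,i}\setminus\{e_r-e_s\mid1<r<s<i\}$. *)

(* Defs.v *)
From mathcomp Require Import all_boot all_order all_fingroup all_algebra.

Set Implicit Arguments.
Unset Strict Implicit.
Unset Printing Implicit Defensive.

Import GroupScope GRing.Theory.
Local Open Scope ring_scope.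

(* Coordinates are numbered from 1, so that [e n i] is the i-th vector of the
   canonical basis of Z^n for 1 <= i <= n, and is 0 for any other i. *)
Definition e (n i : nat) : 'rV[int]_n := \row_(j < n) (j.+1 == i)%:R.

Definition posB (n : nat) : seq 'rV[int]_n :=
  [seq e n i | i <- index_iota 1 n.+1]
  ++ [seq e n i - e n j | i <- index_iota 1 n.+1, j <- index_iota i.+1 n.+1]
  ++ [seq e n i + e n j | i <- index_iota 1 n.+1, j <- index_iota i.+1 n.+1].

(* The finite type of positive roots of type B_n; [val g] is the root [g] as a
   vector. *)
Notation Broot n := (seq_sub (posB n)).

Definition rset (n : nat) (s : seq 'rV[int]_n) : {set Broot n} :=
  [set g | val g \in s].

Definition closed_pattern (n : nat) (S : {set Broot n}) : bool :=
  [forall b in S, forall g in S, forall d : Broot n,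
     (val d == val b + val g) ==> (d \in S)].

Definition normal_in (n : nat) (N S : {set Broot n}) : bool :=
  [&& closed_pattern S, N \subset S &
   [forall b in N, forall g in S, forall d : Broot n,
     (val d == val b + val g) ==> (d \in N)]].

(* n(alpha) *)
Definition nset (n : nat) (al : Broot n) : {set Broot n} :=
  (\bigcap_(N : {set Broot n} | normal_in N setT && (al \in N)) N) :\ al.

(* k(alpha): a union of normal subsets is normal, so the largest one is the
   union of all of them; see [kset_max]. *)
Definition kset (n : nat) (al : Broot n) : {set Broot n} :=
  \bigcup_(N : {set Broot n} | normal_in N setT && (al \notin N)) N.

Lemma closed_patternT (n : nat) : closed_pattern [set: Broot n].
Proof.
apply/forall_inP=> b _; apply/forall_inP=> g _; apply/forallP=> d.
by rewrite in_setT implybT.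
Qed.

Lemma kset_max (n : nat) (al : Broot n) :
  [/\ normal_in (kset al) setT, al \notin kset al &
      forall N : {set Broot n},
        normal_in N setT -> al \notin N -> N \subset kset al].
Proof.
split.
- rewrite /normal_in closed_patternT subsetT /=.
  apply/forall_inP=> b /bigcupP[N PN bN]; apply/forall_inP=> g gT.
  apply/forallP=> d; apply/implyP=> dE; apply/bigcupP; exists N => //.
  case/andP: PN => /and3P[_ _ /forall_inP/(_ b bN)/forall_inP/(_ g gT)] H _.
  by move/forallP/(_ d): H; rewrite dE.
- by apply/bigcupP=> -[N /andP[_ /negP]].
- by move=> N nN aN; apply/bigcup_max: (subxx N); rewrite nN.
Qed.

Lemma nset_min (n : nat) (al : Broot n) :
  normal_in (al |: nset al) setT /\
  forall N : {set Broot n}, normal_in N setT -> al \in N -> al |: nset al \subset N.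
Proof.
have alI : al \in \bigcap_(N | normal_in N setT && (al \in N)) N.
  by apply/bigcapP=> N /andP[].
rewrite /nset setD1K //; split=> [|N nN aN]; last first.
  by apply: bigcap_inf; rewrite nN.
apply/and3P; split; [exact: closed_patternT | exact: subsetT |].
apply/forall_inP=> b /bigcapP bN; apply/forall_inP=> g gT.
apply/forallP=> d; apply/implyP=> dE; apply/bigcapP=> N PN; have bN' := bN N PN.
case/andP: PN => nN _; case/and3P: nN => _ _ /forall_inP/(_ b bN').
move/forall_inP/(_ g gT) => H.
by move/forallP/(_ d): H; rewrite dE.
Qed.

Section RootSubgroups.

Variables (F : finFieldType) (n : nat).

(* The natural module of SO_(2n+1), with quadratic form
     x_0^2 + x_1 x_(-1) + ... + x_n x_(-n);
   the basis is ordered as 1, ..., n, 0, -n, ..., -1. *)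
Local Notation "[+ i ]" := (inord (i - 1) : 'I_(n.*2.+1)) (at level 0, i at level 99).
Local Notation "[- i ]" := (inord (n.*2.+1 - i) : 'I_(n.*2.+1)) (at level 0, i at level 99).
Local Notation "[0]" := (inord n : 'I_(n.*2.+1)) (at level 0).
Local Notation E := (@delta_mx F n.*2.+1 n.*2.+1).

(* The root vectors of the standard Chevalley basis of the simple Lie algebra
   of type B_n (Carter, Simple groups of Lie type, 11.2); exactly one summand
   is nonzero when [g] is a positive root. *)
Definition root_vector (g : 'rV[int]_n) : 'M[F]_(n.*2.+1) :=
  \sum_(1 <= i < n.+1 | g == e n i)
     (E [+ i] [0] *+ 2 - E [0] [- i])
  + \sum_(1 <= i < n.+1) \sum_(i.+1 <= j < n.+1 | g == e n i - e n j)
     (E [+ i] [+ j] - E [- j] [- i])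
  + \sum_(1 <= i < n.+1) \sum_(i.+1 <= j < n.+1 | g == e n i + e n j)
     (E [+ i] [- j] - E [+ j] [- i]).

(* x_g(t) = exp (t e_g), the cube of a root vector being 0 (F is assumed of
   odd characteristic wherever this is used). *)
Definition root_elt (g : Broot n) (t : F) : 'M[F]_(n.*2.+1) :=
  1%:M + t *: root_vector (val g)
  + (t ^+ 2 / 2%:R) *: (root_vector (val g) *m root_vector (val g)).

Definition X (g : Broot n) : {set {'GL_(n.*2.+1)[F]}} :=
  [set x : {'GL_(n.*2.+1)[F]} | [exists t, GLval x == root_elt g t]].

Definition P (S : {set Broot n}) : {group {'GL_(n.*2.+1)[F]}} :=
  <<\bigcup_(g in S) X g>>%G.

End RootSubgroups.

Definition UB (F : finFieldType) (n : nat) : {group {'GL_(n.*2.+1)[F]}} :=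
  P F [set: Broot n].

Definition UA (F : finFieldType) (m : nat) : {set {'GL_(m.+1)[F]}} :=
  [set x : {'GL_(m.+1)[F]} | [forall i : 'I_m.+1, forall j : 'I_m.+1,
     (j <= i)%N ==> (GLval x i j == (i == j)%:R)]].

Section Subsets.

(* The sets of roots attached to alpha = e_1 + e_i. *)
Variables (n i : nat).

Definition a_set : {set Broot n} := rset
  (e n i :: [seq e n i + e n s | s <- index_iota i.+1 n.+1]
         ++ [seq e n i - e n s | s <- index_iota i.+1 n.+1]
         ++ [seq e n 1 - e n s | s <- index_iota 2 i]).

Definition l_set : {set Broot n} := rset
  (e n 1 :: [seq e n 1 + e n s | s <- index_iota i.+1 n.+1]
         ++ [seq e n 1 - e n s | s <- index_iota i.+1 n.+1]
         ++ [seq e n s + e n i | s <- index_iota 2 i]).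

Definition s_set : {set Broot n} := ~: a_set.

Definition b_set : {set Broot n} :=
  let I := [seq t <- index_iota 1 n.+1 | t \notin [:: 1%N; i]] in
  rset ([seq e n t | t <- I]
     ++ [seq e n r + e n s | r <- I, s <- [seq s <- I | (r < s)%N]]
     ++ [seq e n r - e n s | r <- I, s <- [seq s <- I | (r < s)%N]]).

Definition ob_set : {set Broot n} := rset
  [seq e n r - e n i | r <- index_iota 1 i].

Definition kob_set : {set Broot n} :=
  b_set :\: rset [seq e n r - e n s | r <- index_iota 2 i,
                                      s <- index_iota r.+1 i].

End Subsets.

Section Groups.

Variables (F : finFieldType) (n i : nat) (al : Broot n).

Definition Sal : {group {'GL_(n.*2.+1)[F]}} := P F (s_set n i).

Definition Sbar : {group coset_of (P F (kset al))} := (Sal / P F (kset al))%G.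

(* The image of P(l(alpha)) P(k(alpha)) in Sbar. *)
Definition Plbar : {set coset_of (P F (kset al))} :=
  ((P F (l_set n i) * P F (kset al)) / P F (kset al))%g.

Definition TalKer : {group {'GL_(n.*2.+1)[F]}} :=
  P F (al |: (l_set n i :|: kset al)).

Definition Tbar : {group coset_of TalKer} := (Sal / TalKer)%G.

End Groups.

(* [T] is isomorphic to the semidirect product of [H / H0] acting on the normal
   factor [K / K0], the action being induced by conjugation: the coset of [y]
   maps the coset of [x] to the coset of [x ^ y]. *)
Definition isog_sdprod_conj (gT rT : finGroupType) (T : {group rT})
    (H H0 K K0 : {group gT}) : Prop :=
  [/\ H0 <| H, K0 <| K, H \subset 'N(K), H \subset 'N(K0) &
   exists (h : {morphism (H / H0)%g >-> rT}) (k : {morphism (K / K0)%g >-> rT}),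
     [/\ 'injm h, 'injm k,
         (k @* (K / K0) ><| h @* (H / H0))%g = T &
         {in H & K, forall y x,
            k (coset K0 (x ^ y)) = (k (coset K0 x) ^ h (coset H0 y))%g}]].

(* Main.v *)
(* A positive root of type B_n is a sum [wt a + wt c] for an unordered pair
   {a, c} of distinct positions with a + c < 2n, and its root vector has its
   two nonzero entries at (a, 2n - c) and (c, 2n - a).  The sum of {a, c} and
   {2n - c, d} is {a, d}, so that all closure properties of the root sets
   reduce to a finite check on the seven classes of positions with respect to
   0, I = i - 1 and their mirrors 2n and 2n - I.
     For M normal in a closed set S, P(M) is exactly the group of orthogonal
   unipotent matrices whose entries vanish outside M and the composites of M
   with S: the entry of least height of such a matrix sits at a root position
   (orthogonality is linear there and q is odd, so it is not at a mirror
   position), and root elements clear the entries one at a time.  Normality,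
   intersections and products of pattern groups can thus be read off from sets
   of roots, which gives (a), (b), (c).  For (d), (e), (f), P(b) is identified
   with UB_(n-2) by deleting the rows and columns 0, I, 2n - I and 2n, a
   complement of P(kob) in P(b) is the image of the unitriangular group under
   the Levi embedding, and P(ob) is abelian with coordinates the entries in
   column I. *)

Require Import Defs.
From mathcomp Require Import all_boot all_order all_fingroup all_algebra.
From mathcomp Require Import commutator zify ring.

Set Implicit Arguments.
Unset Strict Implicit.
Unset Printing Implicit Defensive.

Import GroupScope GRing.Theory.
Local Open Scope ring_scope.

(** * Positive roots as pairs of positions *)

(** Positions stand for the weights of the natural module, 0 included, so the three families e_i,
    e_i - e_j, e_i + e_j become one: position n has weight 0, and e_i is the pair {i - 1, n}. Adding
    roots becomes composing matrix positions, (x, y) followed by (y, z). The obstacle is that the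
    positions of its roots do not suffice to describe a pattern group by matrix entries. The square
    of a short root vector, or the product of the root vectors of e_i - e_j and e_i + e_j, reaches a
    mirror position (x, 2n - x), whose weight is twice a basis vector and no root. The relation
    [chain] admits these positions, and paths of two steps are enough because among three
    consecutive steps two adjacent ones always compose to a root. Entries at mirror positions carry
    no freedom of their own, since a lowest entry never sits there. The elimination criterion
    [P_lowest] therefore asks only where lowest entries can lie. It gives the matrix description of
    P(M), the intersections, the image of the Levi embedding and the injectivity of the coordinates
    on P(ob). *)

Section Weights.

Variable n : nat.

(* The weight of the basis vector at (0-based) position [a] of the natural
   module: e_(a+1) for a < n, 0 for a = n, and opposite at mirror positions
   [a] and [2n - a]. *)
Definition wt (a : nat) : 'rV[int]_n :=
  \row_(j < n) ((a == j)%:R - (a + j == n.*2)%N%:R).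

Definition wtc (a x : nat) : int := (a == x)%:R - (a + x == n.*2)%N%:R.

(** Odd extension of the coordinates under the mirror x |-> 2n - x. It turns an equality of weights
    into equations in [wtc] at every position, with no case distinction against n. *)
Definition ext (v : 'rV[int]_n) (x : nat) : int :=
  oapp (v 0) 0 (insub x) - oapp (v 0) 0 (insub (n.*2 - x)%N).

Lemma extD v w x : ext (v + w) x = ext v x + ext w x.
Proof.
rewrite /ext; case: insub => [i|]; case: insub => [j|] /=;
  by rewrite ?mxE ?addr0 ?opprD ?oppr0 ?addr0 ?add0r // addrACA.
Qed.

Lemma ext_wt a x : (a <= n.*2)%N -> (x <= n.*2)%N -> ext (wt a) x = wtc a x.
Proof.
move=> ale xle; rewrite /ext /wtc.
by case: insubP => [i xlt ix|]; case: insubP => [j jlt jx|] /=; rewrite ?mxE ?ix ?jx => *; lia.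
Qed.

Lemma wtN a : (a <= n.*2)%N -> wt (n.*2 - a) = - wt a.
Proof. by move=> ale; apply/rowP=> j; rewrite !mxE; have := ltn_ord j; lia. Qed.

Lemma wt0 : wt n = 0.
Proof. by apply/rowP=> j; rewrite !mxE; have := ltn_ord j; lia. Qed.

Lemma e_wt a : (a < n)%N -> e n a.+1 = wt a.
Proof. by move=> ale; apply/rowP=> j; rewrite !mxE; have := ltn_ord j; lia. Qed.

(* The unordered pairs {a, c} describing the positive roots [wt a + wt c]. *)
Definition posp (a c : nat) := (a != c) && (a + c < n.*2)%N.

Lemma pospC a c : posp a c = posp c a.
Proof. by rewrite /posp eq_sym addnC. Qed.

Lemma posp_le a c : posp a c -> (a <= n.*2)%N /\ (c <= n.*2)%N.
Proof. by rewrite /posp; lia. Qed.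

Definition same_pair (a c a' c' : nat) :=
  ((a == a') && (c == c')) || ((a == c') && (c == a')).

Lemma same_pair_sym a c a' c' : same_pair a c a' c' = same_pair a' c' a c.
Proof.
by rewrite /same_pair [a' == a]eq_sym [c' == c]eq_sym [a' == c]eq_sym [c' == a]eq_sym
  [in X in _ || X]andbC.
Qed.

Lemma wt_inj a b : (a <= n.*2)%N -> (b <= n.*2)%N -> wt a = wt b -> a = b.
Proof.
move=> ale ble /(congr1 ext) E; have := congr1 (@^~ a) E; have := congr1 (@^~ b) E.
by rewrite /= !ext_wt // /wtc; lia.
Qed.

(** If [a' < c'] then [a' < n], and the right side is positive at [a']. So a or c equals [a'], and
    cancelling it determines the other position. *)
Lemma wt_pair a c a' c' : (a <= n.*2)%N -> (c <= n.*2)%N -> posp a' c' ->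
  wt a + wt c = wt a' + wt c' -> same_pair a c a' c'.
Proof.
move=> ale cle; wlog lta'c' : a' c' / (a' < c')%N => [W|] pac' E.
  have [lt|lt|eq] := ltngtP a' c'; first exact: W.
    have := W _ _ lt; rewrite pospC [wt c' + _]addrC => /(_ pac' E).
    by rewrite /same_pair orbC.
  by move: pac'; rewrite /posp eq eqxx.
have [a'le c'le] := posp_le pac'.
have := congr1 (ext^~ a') E; rewrite !extD !ext_wt // /wtc => Ea.
have /orP[/eqP aa|/eqP ca] : (a == a') || (c == a') by move: pac'; rewrite /posp; lia.
  move: E; rewrite aa => /addrI /wt_inj-> //; by rewrite /same_pair !eqxx.
move: E; rewrite ca addrC => /addrI /wt_inj-> //; by rewrite /same_pair !eqxx orbT.
Qed.

(** When no term mirrors x, the left side is at least 1. The right side is at most 1 because p and q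
    differ, so both are 1. *)
Lemma wtc_uncancelled x y z t p q :
    y != x -> (y + x != n.*2)%N -> (z + x != n.*2)%N -> (t + x != n.*2)%N ->
    x != n -> p != q ->
    wtc x x + wtc y x + (wtc z x + wtc t x) = wtc p x + wtc q x ->
  [&& (x == p) || (x == q), x != z & x != t].
Proof.
rewrite /wtc => /negPf-> /negPf-> /negPf-> /negPf-> xn pq.
have /negPf-> : (x + x != n.*2)%N by lia.
rewrite eqxx [x == p]eq_sym [x == q]eq_sym [x == z]eq_sym [x == t]eq_sym.
have : ~~ ((p == x) && (q == x)) by apply: contra pq => /andP[/eqP-> /eqP->].
case: (p == x); case: (q == x); case: (z == x); case: (t == x);
  by case: (_ == _); case: (_ == _).
Qed.

(** If nothing cancelled, at most one of the four positions would be n, as two equal to n would be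
    mirrors of each other. By [wtc_uncancelled] three others would be distinct elements of {p,
    q}. *)
Lemma posp_sum_cancel a c a' c' p q : posp a c -> posp a' c' -> posp p q ->
  wt a + wt c + (wt a' + wt c') = wt p + wt q ->
  [|| c + a' == n.*2, c + c' == n.*2, a + a' == n.*2 | a + c' == n.*2]%N.
Proof.
move=> pac pac' ppq E.
have [[ale cle] [a'le c'le]] := (posp_le pac, posp_le pac').
have [ple qle] := posp_le ppq.
have H x : (x <= n.*2)%N ->
    wtc a x + wtc c x + (wtc a' x + wtc c' x) = wtc p x + wtc q x.
  by move=> xle; have := congr1 (ext^~ x) E; rewrite !extD !ext_wt.
move: pac pac' ppq; rewrite /posp => /andP[ac acn] /andP[ac' acn'] /andP[pq _].
apply/negPn/negP; rewrite !negb_or => /and4P[n1 n2 n3 n4].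
have [c_a c'_a'] : c != a /\ c' != a' by rewrite eq_sym ac eq_sym ac'.
have [ca c'a'] : (c + a != n.*2)%N /\ (c' + a' != n.*2)%N.
  by rewrite ![(_ + a)%N]addnC ![(_ + a')%N]addnC !neq_ltn acn acn'.
have [a'c c'c a'a c'a] : [/\ a' + c != n.*2, c' + c != n.*2,
    a' + a != n.*2 & c' + a != n.*2]%N.
  by rewrite ![(c' + _)%N]addnC ![(a' + _)%N]addnC.
have Ha : a != n -> [&& (a == p) || (a == q), a != a' & a != c'].
  by move=> an; apply: (@wtc_uncancelled a c) (H a ale).
have Hc : c != n -> [&& (c == p) || (c == q), c != a' & c != c'].
  move=> cn; have := H c cle; rewrite [wtc a c + _]addrC.
  by apply: wtc_uncancelled => //; rewrite addnC.
have Ha' : a' != n -> [&& (a' == p) || (a' == q), a' != a & a' != c].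
  move=> an; have := H a' a'le; rewrite addrC.
  by apply: wtc_uncancelled => //; rewrite addnC.
have Hc' : c' != n -> [&& (c' == p) || (c' == q), c' != a & c' != c].
  move=> cn; have := H c' c'le; rewrite addrC [wtc a' c' + _]addrC.
  by apply: wtc_uncancelled => //; rewrite addnC.
have pigeon x y z : (x == p) || (x == q) -> (y == p) || (y == q) ->
    (z == p) || (z == q) -> x != y -> x != z -> y != z -> False.
  by clear; lia.
have [an|/Ha/and3P[Aa a1 a2]] := eqVneq a n.
  have /Hc/and3P[Ac c1 c2] : c != n by rewrite -an.
  have /Ha'/and3P[Aa' _ _] : a' != n by move: n3; rewrite an; clear; lia.
  have /Hc'/and3P[Ac' _ _] : c' != n by move: n4; rewrite an; clear; lia.
  exact: (pigeon c a' c').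
have [a'n|/Ha'/and3P[Aa' _ a3]] := eqVneq a' n.
  have /Hc/and3P[Ac _ c2] : c != n by move: n1; rewrite a'n; clear; lia.
  have /Hc'/and3P[Ac' _ _] : c' != n by rewrite -a'n.
  exact: (pigeon a c c').
have [cn|/Hc/and3P[Ac c1 c2]] := eqVneq c n.
  have /Hc'/and3P[Ac' _ _] : c' != n by move: n2; rewrite cn; clear; lia.
  exact: (pigeon a a' c').
exact: (pigeon a a' c).
Qed.

Lemma e_wtn r : (0 < r <= n)%N -> e n r = wt r.-1 + wt n.
Proof. by case: r => // r rn; rewrite wt0 addr0 e_wt. Qed.

Lemma e_wtD r s : (0 < r <= n)%N -> (0 < s <= n)%N ->
  e n r + e n s = wt r.-1 + wt s.-1.
Proof. by case: r s => [|r] [|s] // rn sn; rewrite !e_wt. Qed.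

Lemma e_wtB r s : (0 < r <= n)%N -> (0 < s <= n)%N ->
  e n r - e n s = wt r.-1 + wt (n.*2 - s.-1).
Proof. by case: r s => [|r] [|s] // rn sn; rewrite !e_wt // wtN //; lia. Qed.

Lemma mem_map_wt (f : nat -> 'rV_n) (u v : nat -> nat) (L : seq nat) a c :
    posp a c -> (forall s, s \in L -> f s = wt (u s) + wt (v s)) ->
    (forall s, s \in L -> u s <= n.*2 /\ v s <= n.*2)%N ->
  reflect (exists2 s, s \in L & same_pair a c (u s) (v s))
          (wt a + wt c \in [seq f s | s <- L]).
Proof.
move=> pac fE uv; apply: (iffP mapP) => [[s sL]|[s sL]].
  rewrite fE // => E; exists s => //; have [us vs] := uv s sL.
  by rewrite same_pair_sym; apply: wt_pair.
rewrite /same_pair => /orP[] /andP[/eqP-> /eqP->]; exists s; rewrite ?fE //.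
by rewrite addrC.
Qed.

Lemma mem_allpairs_wt (f : nat -> nat -> 'rV_n) (u v : nat -> nat -> nat)
    (L : seq nat) (L' : nat -> seq nat) a c : posp a c ->
    (forall r s, r \in L -> s \in L' r -> f r s = wt (u r s) + wt (v r s)) ->
    (forall r s, r \in L -> s \in L' r -> u r s <= n.*2 /\ v r s <= n.*2)%N ->
  reflect (exists r s, [/\ r \in L, s \in L' r & same_pair a c (u r s) (v r s)])
          (wt a + wt c \in [seq f r s | r <- L, s <- L' r]).
Proof.
move=> pac fE uv; apply: (iffP allpairsPdep) => [[r [s [rL sL]]]|[r [s [rL sL]]]].
  rewrite fE // => E; exists r, s; split=> //; have [us vs] := uv r s rL sL.
  by rewrite same_pair_sym; apply: wt_pair.
rewrite /same_pair => /orP[] /andP[/eqP-> /eqP->]; exists r, s; rewrite ?fE //.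
by rewrite addrC.
Qed.

(** For [a < c] the root is e_(a+1) + e_(c+1), e_(a+1) - e_(2n-c+1) or e_(a+1), according to whether
    c is below, above or equal to n. *)
Lemma posB_wt a c : posp a c -> wt a + wt c \in posB n.
Proof.
wlog ltac : a c / (a < c)%N => [W|] pac.
  have [lt|lt|eq] := ltngtP a c; first exact: W.
    by rewrite addrC W // pospC.
  by move: pac; rewrite /posp eq eqxx.
have := pac; rewrite /posp => /andP[_ lt2]; rewrite /posB !mem_cat; apply/or3P.
have [cn|cn|cn] := ltngtP c n.
- apply: Or33; apply/(@mem_allpairs_wt _ (fun r _ => r.-1) (fun _ s => s.-1)) => //.
  + by move=> r s; rewrite !mem_index_iota => *; apply: e_wtD; lia.
  + by move=> r s; rewrite !mem_index_iota; lia.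
  by exists a.+1, c.+1; rewrite !mem_index_iota /same_pair !eqxx; split=> //; lia.
- apply: Or32; apply/(@mem_allpairs_wt _ (fun r _ => r.-1) (fun _ s => n.*2 - s.-1)%N) => //.
  + by move=> r s; rewrite !mem_index_iota => *; apply: e_wtB; lia.
  + by move=> r s; rewrite !mem_index_iota; lia.
  by exists a.+1, (n.*2 - c).+1; rewrite !mem_index_iota /same_pair; split=> //=; lia.
- apply: Or31; apply/(@mem_map_wt _ (fun r => r.-1) (fun _ => n)) => //.
  + by move=> r; rewrite !mem_index_iota => *; apply: e_wtn; lia.
  + by move=> r; rewrite !mem_index_iota; lia.
  by exists a.+1; rewrite ?mem_index_iota /same_pair /= ?cn ?eqxx //; lia.
Qed.

Lemma posB_posp v : v \in posB n ->
  exists a c, [/\ (a < c)%N, posp a c & v = wt a + wt c].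
Proof.
rewrite /posB !mem_cat => /or3P[/mapP[r]|/allpairsPdep[r [s [rI sI]]]|
  /allpairsPdep[r [s [rI sI]]]].
- rewrite mem_index_iota => rI ->; exists r.-1, n; rewrite e_wtn; last by lia.
  by rewrite /posp; split=> //; lia.
- move: rI sI; rewrite !mem_index_iota => rI sI ->.
  exists r.-1, (n.*2 - s.-1)%N; rewrite e_wtB; try lia.
  by rewrite /posp; split=> //; lia.
- move: rI sI; rewrite !mem_index_iota => rI sI ->.
  exists r.-1, s.-1; rewrite e_wtD; try lia.
  by rewrite /posp; split=> //; lia.
Qed.

Lemma BrootP (g : Broot n) : exists a c, [/\ (a < c)%N, posp a c & val g = wt a + wt c].
Proof. exact/posB_posp/valP. Qed.

(** A set of roots seen as a symmetric relation on positions, so that membership can be computed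
    without naming the root. *)
Definition sr (S : {set Broot n}) (a c : nat) : bool :=
  posp a c && [exists g in S, val g == wt a + wt c].

Lemma sr_posp S a c : sr S a c -> posp a c. Proof. by case/andP. Qed.

Lemma srC S a c : sr S a c = sr S c a.
Proof. by rewrite /sr pospC addrC. Qed.

Lemma sr_root (g : Broot n) a c S :
  posp a c -> val g = wt a + wt c -> sr S a c = (g \in S).
Proof.
move=> pac gE; rewrite /sr pac /=; apply/exists_inP/idP => [[h hS]|gS].
  by rewrite -gE => /eqP/val_inj <-.
by exists g => //; rewrite gE.
Qed.

Lemma ex_root a c : posp a c -> exists g : Broot n, val g = wt a + wt c.
Proof. by move=> pac; exists (SeqSub (posB_wt pac)). Qed.

Lemma sr_sub (S S' : {set Broot n}) :
  (S \subset S') <-> (forall a c, sr S a c -> sr S' a c).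
Proof.
split=> [/subsetP sSS' a c sac|H].
  have pac := sr_posp sac; have [g gE] := ex_root pac.
  by move: sac; rewrite !(sr_root _ pac gE); apply: sSS'.
apply/subsetP=> g gS; have [a [c [_ pac gE]]] := BrootP g.
by rewrite -(sr_root _ pac gE) H // (sr_root _ pac gE).
Qed.

Lemma sr_eq (S S' : {set Broot n}) :
  (forall a c, posp a c -> sr S a c = sr S' a c) -> S = S'.
Proof.
move=> H; apply/setP=> g; have [a [c [_ pac gE]]] := BrootP g.
by rewrite -!(sr_root _ pac gE) H.
Qed.

Lemma sr_rset s a c : sr (rset s) a c = posp a c && (wt a + wt c \in s).
Proof.
have [pac|/negPf npac] := boolP (posp a c); last by rewrite /sr npac.
by have [g gE] := ex_root pac; rewrite (sr_root _ pac gE) inE gE.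
Qed.

Lemma sr_set0 a c : sr set0 a c = false.
Proof. by rewrite /sr; apply/andP=> -[_ /exists_inP[g]]; rewrite inE. Qed.

Lemma sr_setT a c : sr setT a c = posp a c.
Proof.
have [pac|/negPf npac] := boolP (posp a c); last by rewrite /sr npac.
by have [g gE] := ex_root pac; rewrite (sr_root _ pac gE) inE.
Qed.

Lemma sr_setU A B a c : sr (A :|: B) a c = sr A a c || sr B a c.
Proof.
have [pac|/negPf npac] := boolP (posp a c); last by rewrite /sr npac.
by have [g gE] := ex_root pac; rewrite !(sr_root _ pac gE) inE.
Qed.

Lemma sr_setI A B a c : sr (A :&: B) a c = sr A a c && sr B a c.
Proof.
have [pac|/negPf npac] := boolP (posp a c); last by rewrite /sr npac.
by have [g gE] := ex_root pac; rewrite !(sr_root _ pac gE) inE.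
Qed.

Lemma sr_setD A B a c : sr (A :\: B) a c = sr A a c && ~~ sr B a c.
Proof.
have [pac|/negPf npac] := boolP (posp a c); last by rewrite /sr npac.
by have [g gE] := ex_root pac; rewrite !(sr_root _ pac gE) inE andbC.
Qed.

Lemma sr_setC A a c : sr (~: A) a c = posp a c && ~~ sr A a c.
Proof. by rewrite -setTD sr_setD sr_setT. Qed.

Lemma sr_set1 g a c x y : posp x y -> val g = wt x + wt y ->
  sr [set g] a c = same_pair a c x y.
Proof.
move=> pxy gE; have [pac|npac] := boolP (posp a c); last first.
  rewrite /sr (negPf npac); apply/esym/negP => /orP[] /andP[/eqP ax /eqP cy].
    by rewrite ax cy pxy in npac.
  by rewrite ax cy pospC pxy in npac.
have [h hE] := ex_root pac; rewrite (sr_root _ pac hE) inE.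
apply/eqP/idP => [hg|].
  have [[? ?] [? ?]] := (posp_le pac, posp_le pxy).
  by apply: wt_pair => //; rewrite -hE hg.
by case/orP=> /andP[/eqP ax /eqP cy]; apply: val_inj; rewrite /= hE gE ax cy // addrC.
Qed.

(** The relation p need not be symmetric, since [sr_pset] takes both orders. Positions of a root are
    below 2n, so these ordinals are enough. *)
Definition pset (p : rel nat) : {set Broot n} :=
  [set g : Broot n | [exists a : 'I_n.*2, exists c : 'I_n.*2,
     p a c && (val g == wt a + wt c)]].

Lemma sr_pset p a c : sr (pset p) a c = posp a c && (p a c || p c a).
Proof.
have [pac|/negPf npac] := boolP (posp a c); last by rewrite /sr npac.
have [g gE] := ex_root pac; rewrite (sr_root _ pac gE) inE gE /=.
apply/existsP/idP => [[x /existsP[y /andP[pxy /eqP E]]]|].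
  have : same_pair x y a c by apply: wt_pair => //; apply: ltnW.
  by case/orP=> /andP[/eqP <- /eqP <-]; rewrite pxy ?orbT.
have [an cn] : (a < n.*2)%N /\ (c < n.*2)%N by move: pac; rewrite /posp; lia.
case/orP=> pxy; [exists (Ordinal an) | exists (Ordinal cn)]; apply/existsP.
  by exists (Ordinal cn); rewrite pxy /=.
by exists (Ordinal an); rewrite pxy /= addrC.
Qed.

(** By [posp_sum_cancel] one position y of b meets its mirror in g. [W] treats one placement of y,
    and the four cases reduce to it by swapping the pairs. *)
Lemma root_sum (b g d : Broot n) : val d = val b + val g ->
  exists x y z, [/\ posp x y, posp (n.*2 - y) z & posp x z] /\
    [/\ val b = wt x + wt y, val g = wt (n.*2 - y) + wt z & val d = wt x + wt z].
Proof.
move=> E; have [a [c [_ pac bE]]] := BrootP b.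
have [a' [c' [_ pac' gE]]] := BrootP g; have [p [q [_ ppq dE]]] := BrootP d.
suff W x y z : posp x y -> posp (n.*2 - y) z -> val b = wt x + wt y ->
    val g = wt (n.*2 - y) + wt z ->
  [/\ posp x y, posp (n.*2 - y) z & posp x z] /\
    [/\ val b = wt x + wt y, val g = wt (n.*2 - y) + wt z & val d = wt x + wt z].
  have [[? ?] [? ?]] := (posp_le pac, posp_le pac').
  have E' : wt a + wt c + (wt a' + wt c') = wt p + wt q by rewrite -bE -gE -E.
  have /or4P[] := posp_sum_cancel pac pac' ppq E'.
  - move=> ca; exists a, c, c'; have a'E : (n.*2 - c = a')%N by lia.
    by apply: W; rewrite // a'E.
  - move=> ca; exists a, c, a'; have a'E : (n.*2 - c = c')%N by lia.
    by apply: W; rewrite // a'E // 1?pospC // addrC.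
  - move=> ca; exists c, a, c'; have a'E : (n.*2 - a = a')%N by lia.
    by apply: W; rewrite // ?a'E // 1?pospC // addrC.
  - move=> ca; exists c, a, a'; have a'E : (n.*2 - a = c')%N by lia.
    by apply: W; rewrite // ?a'E // 1?pospC // addrC.
move=> pxy pyz bE' gE'; have [[xn yn] [yn' zn]] := (posp_le pxy, posp_le pyz).
have dE' : val d = wt x + wt z.
  by rewrite E bE' gE' wtN // addrA addrK.
have [? ?] := posp_le ppq.
have := @wt_pair x z p q xn zn ppq; rewrite -dE' -dE => /(_ erefl).
case/orP=> /andP[/eqP xp /eqP zq]; rewrite xp zq dE ?[posp q p]pospC.
  by split; split=> //; rewrite -?xp -?zq.
by split; split=> //; rewrite -?xp -?zq // addrC.
Qed.

(** Common form of closure ([N = S]) and of the stability of a normal subset; y is the position that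
    cancels. *)
Definition add_stable (N S : {set Broot n}) : Prop :=
  forall x y z, sr N x y -> sr S (n.*2 - y) z -> posp x z -> sr N x z.

Lemma add_stableP (N S : {set Broot n}) :
  reflect (add_stable N S)
    [forall b in N, forall g in S, forall d : Broot n,
      (val d == val b + val g) ==> (d \in N)].
Proof.
apply: (iffP forall_inP) => [H x y z xy yz xz|H b bN].
  have [pxy pyz] := (sr_posp xy, sr_posp yz).
  have [[[b bE] [g gE]] [d dE]] := (ex_root pxy, ex_root pyz, ex_root xz).
  move: xy yz; rewrite (sr_root _ pxy bE) (sr_root _ pyz gE) (sr_root _ xz dE).
  move=> bN gS; have /forall_inP/(_ g gS)/forallP/(_ d)/implyP := H b bN; apply.
  by rewrite bE gE dE wtN ?addrA ?addrK //; case: (posp_le pxy).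
apply/forall_inP=> g gS; apply/forallP=> d; apply/implyP=> /eqP/root_sum.
case=> x [y [z [[pxy pyz pxz] [bE gE dE]]]].
by rewrite -(sr_root _ pxz dE) (H x y) // ?(sr_root _ pxy bE) ?(sr_root _ pyz gE).
Qed.

Lemma closed_patternP (S : {set Broot n}) :
  reflect (add_stable S S) (closed_pattern S).
Proof. exact: add_stableP. Qed.

Lemma normal_inP (N S : {set Broot n}) :
  reflect [/\ add_stable S S, N \subset S & add_stable N S] (normal_in N S).
Proof.
apply: (iffP and3P) => [[/closed_patternP ? ? /add_stableP ?]|[cS sNS nN]]; split=> //.
  exact/closed_patternP.
exact/add_stableP.
Qed.

End Weights.

(** * The root sets of the statement in terms of classes of positions *)

Section RootSets.

Variables (n I : nat).
Hypotheses (I_gt0 : (0 < I)%N) (I_lt_n : (I < n)%N).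

(* All root sets of the statement are unions of products of the seven classes
   {0}, ]0, I[, {I}, ]I, 2n - I[, {2n - I}, ]2n - I, 2n[ and {2n} of positions,
   which the mirror a |-> 2n - a exchanges as c |-> 6 - c. *)
Definition cls (a : nat) : nat :=
  (if a == 0 then 0 else if a < I then 1 else if a == I then 2
   else if a < n.*2 - I then 3 else if a == n.*2 - I then 4
   else if a < n.*2 then 5 else 6)%N.

(** These predicates fix one order of the pair and are symmetrised where they are used; only [in_b]
    and [in_k] are symmetric already. *)
Definition in_a (c d : nat) : bool := ((c == 2) && (d == 3) || (c == 0) && (d == 5))%N.
Definition in_l (c d : nat) : bool := ((c == 0) && (d == 3) || (c == 2) && (d == 1))%N.
Definition in_b (c d : nat) : bool := ((c \notin [:: 0; 2; 4]) && (d \notin [:: 0; 2; 4]))%N.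
Definition in_ob (c d : nat) : bool := ((c < 2)%N && (d == 4))%N.
(** The roots e_r - e_s with 1 < r < s < i that are removed from b to form kob. *)
Definition in_lev (c d : nat) : bool := ((c == 1) && (d == 5))%N.
Definition in_k (c d : nat) : bool := ((c < 2)%N && (d < 2)%N)%N.
Definition in_al (c d : nat) : bool := ((c == 0) && (d == 2))%N.

Lemma cls_mirror a : (a <= n.*2)%N -> cls (n.*2 - a) = (6 - cls a)%N.
Proof. by rewrite /cls => an; do ?case: ifP; lia. Qed.

Lemma cls_le6 a : (cls a <= 6)%N.
Proof. by rewrite /cls; do ?case: ifP. Qed.

Lemma cls0 a : (cls a == 0%N) = (a == 0)%N.
Proof. by rewrite /cls; do 6?case: ifP; lia. Qed.
Lemma cls1 a : (cls a == 1%N) = (0 < a < I)%N.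
Proof. by rewrite /cls; do 6?case: ifP; lia. Qed.
Lemma cls2 a : (cls a == 2%N) = (a == I)%N.
Proof. by rewrite /cls; do 6?case: ifP; lia. Qed.
Lemma cls3 a : (cls a == 3%N) = (I < a < n.*2 - I)%N.
Proof. by rewrite /cls; do 6?case: ifP; lia. Qed.
Lemma cls4 a : (cls a == 4%N) = (a == n.*2 - I)%N.
Proof. by rewrite /cls; do 6?case: ifP; lia. Qed.
Lemma cls5 a : (cls a == 5%N) = (n.*2 - I < a < n.*2)%N.
Proof. by rewrite /cls; do 6?case: ifP; lia. Qed.
Lemma cls_lt2 a : (cls a < 2)%N = (a < I)%N.
Proof. by rewrite /cls; do 6?case: ifP; lia. Qed.

Definition clsE := (cls0, cls1, cls2, cls3, cls4, cls5, cls_lt2).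

Lemma mem_wt1 r s a c : posp n a c -> (r <= n.*2)%N -> (s <= n.*2)%N ->
  (wt n a + wt n c == wt n r + wt n s) = same_pair a c r s.
Proof.
move=> pac rn sn; have [? ?] := posp_le pac; apply/eqP/idP => [E|].
  by rewrite same_pair_sym; apply: (wt_pair _ _ pac).
by case/orP=> /andP[/eqP-> /eqP->] //; rewrite addrC.
Qed.

Lemma mem_eD r lo hi a c : posp n a c -> (0 < r <= n)%N -> (0 < lo)%N ->
    (hi <= n.+1)%N ->
  (wt n a + wt n c \in [seq e n r + e n s | s <- index_iota lo hi]) =
  ((a == r.-1) && (lo <= c.+1 < hi) || (c == r.-1) && (lo <= a.+1 < hi))%N.
Proof.
move=> pac rn lo0 hin.
apply/(@mem_map_wt _ _ (fun=> r.-1) (fun s => s.-1) _ _ _ pac)/idP.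
- by move=> s; rewrite mem_index_iota => ?; rewrite e_wtD //; lia.
- by move=> s; rewrite mem_index_iota; lia.
- by case=> s; rewrite mem_index_iota /same_pair; lia.
by case/orP=> /andP[/eqP-> H]; [exists c.+1 | exists a.+1];
   rewrite ?mem_index_iota // /same_pair !eqxx ?orbT.
Qed.

Lemma mem_eB r lo hi a c : posp n a c -> (0 < r <= n)%N -> (0 < lo)%N ->
    (hi <= n.+1)%N ->
  (wt n a + wt n c \in [seq e n r - e n s | s <- index_iota lo hi]) =
  ((a == r.-1) && (lo <= (n.*2 - c).+1 < hi) ||
   (c == r.-1) && (lo <= (n.*2 - a).+1 < hi))%N.
Proof.
move=> pac rn lo0 hin; have [an cn] := posp_le pac.
apply/(@mem_map_wt _ _ (fun=> r.-1) (fun s => n.*2 - s.-1)%N _ _ _ pac)/idP.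
- by move=> s; rewrite mem_index_iota => ?; rewrite e_wtB //; lia.
- by move=> s; rewrite mem_index_iota; lia.
- by case=> s; rewrite mem_index_iota /same_pair; lia.
by case/orP=> /andP[/eqP-> H]; [exists (n.*2 - c).+1 | exists (n.*2 - a).+1];
   rewrite ?mem_index_iota // /same_pair /= subKn // !eqxx ?orbT.
Qed.

Lemma mem_Be r lo hi a c : posp n a c -> (0 < r <= n)%N -> (0 < lo)%N ->
    (hi <= n.+1)%N ->
  (wt n a + wt n c \in [seq e n s - e n r | s <- index_iota lo hi]) =
  ((a == n.*2 - r.-1) && (lo <= c.+1 < hi) ||
   (c == n.*2 - r.-1) && (lo <= a.+1 < hi))%N.
Proof.
move=> pac rn lo0 hin; have [an cn] := posp_le pac.
apply/(@mem_map_wt _ _ (fun=> n.*2 - r.-1)%N (fun s => s.-1) _ _ _ pac)/idP.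
- by move=> s; rewrite mem_index_iota => ?; rewrite e_wtB 1?[RHS]addrC //; lia.
- by move=> s; rewrite mem_index_iota; lia.
- by case=> s; rewrite mem_index_iota /same_pair; lia.
by case/orP=> /andP[/eqP-> H]; [exists c.+1 | exists a.+1];
   rewrite ?mem_index_iota // /same_pair !eqxx ?orbT.
Qed.

(** Class 3 gathers the positions of e_s, 0 and -e_s for s > i, so e_i and all e_i + e_s, e_i - e_s
    form the single product (2, 3). The roots e_1 - e_s with 1 < s < i form (0, 5). *)
Lemma sr_a_set a c :
  sr (a_set n I.+1) a c = posp n a c && (in_a (cls a) (cls c) || in_a (cls c) (cls a)).
Proof.
rewrite sr_rset; case: (boolP (posp n a c)) => //= pac.
rewrite inE !mem_cat mem_eD ?mem_eB ?e_wtn ?mem_wt1 //; try lia.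
have key x y : posp n x y -> [|| (x == I) && (y == n),
    (x == I) && (I.+1 < y.+1 < n.+1), (x == I) && (I.+1 < (n.*2 - y).+1 < n.+1)
    | (x == 0) && (1 < (n.*2 - y).+1 < I.+1)]%N = in_a (cls x) (cls y).
  by rewrite /posp /in_a !clsE; lia.
by rewrite -!key // 1?pospC // /same_pair [(a == n) && _]andbC -!orbA;
  do !bool_congr.
Qed.

Lemma sr_l_set a c :
  sr (l_set n I.+1) a c = posp n a c && (in_l (cls a) (cls c) || in_l (cls c) (cls a)).
Proof.
rewrite sr_rset; case: (boolP (posp n a c)) => //= pac.
rewrite inE !mem_cat (eq_map (fun s => addrC (e n s) (e n I.+1))).
rewrite !mem_eD ?mem_eB ?e_wtn ?mem_wt1 //; try lia.
have key x y : posp n x y -> [|| (x == 0) && (y == n),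
    (x == 0) && (I.+1 < y.+1 < n.+1), (x == 0) && (I.+1 < (n.*2 - y).+1 < n.+1)
    | (x == I) && (1 < y.+1 < I.+1)]%N = in_l (cls x) (cls y).
  by rewrite /posp /in_l !clsE; lia.
by rewrite -!key // 1?pospC // /same_pair [(a == n) && _]andbC -!orbA;
  do !bool_congr.
Qed.

Lemma sr_ob_set a c :
  sr (ob_set n I.+1) a c = posp n a c && (in_ob (cls a) (cls c) || in_ob (cls c) (cls a)).
Proof.
rewrite sr_rset; case: (boolP (posp n a c)) => //= pac.
rewrite mem_Be //; last by lia.
by move: pac; rewrite /posp /in_ob !clsE; lia.
Qed.

Lemma sr_s_set a c :
  sr (s_set n I.+1) a c = posp n a c && ~~ (in_a (cls a) (cls c) || in_a (cls c) (cls a)).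
Proof. by rewrite sr_setC sr_a_set; case: posp. Qed.

Lemma mem_b_idx t :
  (t \in [seq t <- index_iota 1 n.+1 | t \notin [:: 1%N; I.+1]]) =
  [&& t != 1, t != I.+1, 0 < t & t <= n]%N.
Proof. by rewrite mem_filter mem_index_iota !inE; lia. Qed.

Lemma sr_b_set a c : sr (b_set n I.+1) a c = posp n a c && in_b (cls a) (cls c).
Proof.
rewrite sr_rset; case: (boolP (posp n a c)) => //= pac.
have [an cn] := posp_le pac; rewrite !mem_cat.
have idx2 r s : s \in [seq s <- [seq t <- index_iota 1 n.+1 | t \notin [:: 1%N; I.+1]]
   | (r < s)%N] = [&& s != 1, s != I.+1, 0 < s, s <= n & r < s]%N.
  by rewrite mem_filter mem_b_idx; lia.
apply/or3P/idP.
- rewrite /in_b !inE !clsE; case.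
  + case/(@mem_map_wt _ _ (fun r => r.-1) (fun=> n)) => //.
    * by move=> s; rewrite mem_b_idx => ?; rewrite e_wtn //; lia.
    * by move=> s; rewrite mem_b_idx; lia.
    by move=> s; move: pac; rewrite mem_b_idx /posp /same_pair; lia.
  + case/(@mem_allpairs_wt _ _ (fun r _ => r.-1) (fun _ s => s.-1)) => //.
    * by move=> r s; rewrite mem_b_idx idx2 => *; rewrite e_wtD //; lia.
    * by move=> r s; rewrite mem_b_idx idx2; lia.
    by move=> r [s []]; move: pac; rewrite mem_b_idx idx2 /posp /same_pair; lia.
  + case/(@mem_allpairs_wt _ _ (fun r _ => r.-1) (fun _ s => n.*2 - s.-1)%N) => //.
    * by move=> r s; rewrite mem_b_idx idx2 => *; rewrite e_wtB //; lia.
    * by move=> r s; rewrite mem_b_idx idx2; lia.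
    by move=> r [s []]; move: pac; rewrite mem_b_idx idx2 /posp /same_pair; lia.
wlog ltac : a c pac an cn / (a < c)%N => [W|].
  have [lt|lt|eq] := ltngtP a c; first exact: W.
    by rewrite /in_b andbC addrC; apply: W; rewrite // pospC.
  by move: pac; rewrite /posp eq eqxx.
move=> H; have [cn'|cn'|cn'] := ltngtP c n.
- apply: Or32; apply/(@mem_allpairs_wt _ _ (fun r _ => r.-1) (fun _ s => s.-1)) => //.
  + by move=> r s; rewrite mem_b_idx idx2 => *; rewrite e_wtD //; lia.
  + by move=> r s; rewrite mem_b_idx idx2; lia.
  exists a.+1, c.+1; rewrite mem_b_idx idx2 /same_pair !eqxx.
  by move: H; rewrite /in_b !inE !clsE; split=> //; lia.
- apply: Or33; apply/(@mem_allpairs_wt _ _ (fun r _ => r.-1) (fun _ s => n.*2 - s.-1)%N) => //.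
  + by move=> r s; rewrite mem_b_idx idx2 => *; rewrite e_wtB //; lia.
  + by move=> r s; rewrite mem_b_idx idx2; lia.
  exists a.+1, (n.*2 - c).+1; rewrite mem_b_idx idx2 /same_pair /= subKn // !eqxx.
  by move: H pac; rewrite /posp /in_b !inE !clsE; split=> //; lia.
- apply: Or31; apply/(@mem_map_wt _ _ (fun r => r.-1) (fun=> n)) => //.
  + by move=> s; rewrite mem_b_idx => ?; rewrite e_wtn //; lia.
  + by move=> s; rewrite mem_b_idx; lia.
  exists a.+1; last by rewrite /same_pair cn' !eqxx.
  by rewrite mem_b_idx; move: H; rewrite /in_b !inE !clsE; lia.
Qed.

Lemma sr_kob_set a c :
  sr (kob_set n I.+1) a c =
  [&& posp n a c, in_b (cls a) (cls c) & ~~ (in_lev (cls a) (cls c) || in_lev (cls c) (cls a))].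
Proof.
rewrite sr_setD sr_b_set sr_rset; case: (boolP (posp n a c)) => //= pac.
congr (_ && ~~ _); have [an cn] := posp_le pac.
apply/(@mem_allpairs_wt _ _ (fun r _ => r.-1) (fun _ s => n.*2 - s.-1)%N)/idP => //.
- by move=> r s; rewrite !mem_index_iota => *; rewrite e_wtB //; lia.
- by move=> r s; rewrite !mem_index_iota; lia.
- case=> r [s []]; move: pac.
  by rewrite !mem_index_iota /posp /in_lev !clsE /same_pair; lia.
case/orP; rewrite /in_lev !clsE => H; [exists a.+1, (n.*2 - c).+1 | exists c.+1, (n.*2 - a).+1].
  rewrite !mem_index_iota /same_pair /= subKn // !eqxx.
  by move: pac; rewrite /posp; split=> //; lia.
rewrite !mem_index_iota /same_pair /= subKn // !eqxx orbT.
by move: pac; rewrite /posp; split=> //; lia.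
Qed.

End RootSets.

(** * Closure and normality by classes; determination of k(alpha) and n(alpha) *)

Section Patterns.

Variables (n I : nat).
Hypotheses (I_gt0 : (0 < I)%N) (I_lt_n : (I < n)%N).

(** A necessary condition for a root. Excluded are a singleton class paired with itself and two
    mirror singleton classes, whose positions add up to 2n. *)
Definition posc (c d : nat) : bool :=
  (c + d <= 6)%N && ((c, d) \notin [:: (0, 0); (2, 2); (2, 4); (4, 2); (0, 6); (6, 0)]).

Lemma posp_cls a c : posp n a c -> posc (cls n I a) (cls n I c).
Proof.
by rewrite /posp /posc /cls => ac; move: ac; do ?case: ifP; rewrite !inE !xpair_eqE; lia.
Qed.

Definition has_cls (S : {set Broot n}) (p : rel nat) :=
  forall a c, sr S a c = posp n a c && p (cls n I a) (cls n I c).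

Definition cls_stable (p q : rel nat) : bool :=
  all (fun x => all (fun y => all (fun z =>
    [&& posc x y, p x y, posc (6 - y)%N z, q (6 - y)%N z & posc x z] ==> p x z)
    (iota 0 7)) (iota 0 7)) (iota 0 7).

(** The roots involved satisfy [posc], and mirroring y turns its class into [6 - y]. A check of the
    343 triples of classes thus settles all n and I at once. *)
Lemma cls_stableP N S p q : has_cls N p -> has_cls S q -> cls_stable p q ->
  add_stable N S.
Proof.
move=> Np Sq /allP pq x y z; rewrite Np Sq => /andP[xy pxy] /andP[yz qyz] xz.
have [_ /(cls_mirror I_gt0 I_lt_n) yE] := posp_le xy.
have cI a : cls n I a \in iota 0 7 by rewrite mem_iota ltnS cls_le6.
have /allP/(_ _ (cI y))/allP/(_ _ (cI z)) := pq _ (cI x).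
by rewrite Np xz -yE !posp_cls // pxy qyz.
Qed.

Lemma has_clsU A B p q : has_cls A p -> has_cls B q ->
  has_cls (A :|: B) (fun c d => p c d || q c d).
Proof. by move=> Ap Bq a c; rewrite sr_setU Ap Bq; case: posp. Qed.

Lemma has_clsI A B p q : has_cls A p -> has_cls B q ->
  has_cls (A :&: B) (fun c d => p c d && q c d).
Proof. by move=> Ap Bq a c; rewrite sr_setI Ap Bq; case: posp. Qed.

Lemma has_clsD A B p q : has_cls A p -> has_cls B q ->
  has_cls (A :\: B) (fun c d => p c d && ~~ q c d).
Proof. by move=> Ap Bq a c; rewrite sr_setD Ap Bq; case: posp. Qed.

Lemma has_clsT : has_cls setT (fun _ _ => true).
Proof. by move=> a c; rewrite sr_setT andbT. Qed.

Lemma has_cls_eq A B p q : has_cls A p -> has_cls B q ->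
  all (fun x => all (fun y => posc x y ==> (p x y == q x y)) (iota 0 7)) (iota 0 7) ->
  A = B.
Proof.
move=> Ap Bq /allP pq; apply: sr_eq => a c pac; rewrite Ap Bq pac.
have cI a' : cls n I a' \in iota 0 7 by rewrite mem_iota ltnS cls_le6.
by have /allP/(_ _ (cI c)) := pq _ (cI a); rewrite posp_cls // => /eqP.
Qed.

Lemma has_cls_sub A B p q : has_cls A p -> has_cls B q ->
  all (fun x => all (fun y => posc x y && p x y ==> q x y) (iota 0 7)) (iota 0 7) ->
  A \subset B.
Proof.
move=> Ap Bq /allP pq; apply/sr_sub => a c; rewrite Ap Bq => /andP[pac pxy].
have cI a' : cls n I a' \in iota 0 7 by rewrite mem_iota ltnS cls_le6.
by have /allP/(_ _ (cI c)) := pq _ (cI a); rewrite posp_cls // pxy pac.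
Qed.

Definition symm (p : rel nat) : rel nat := fun c d => p c d || p d c.

Definition k_set : {set Broot n} := pset n (fun a c => in_k (cls n I a) (cls n I c)).
Notation k := k_set.
Notation s := (s_set n I.+1).
Notation l := (l_set n I.+1).
Notation b := (b_set n I.+1).
Notation ob := (ob_set n I.+1).
Notation kob := (kob_set n I.+1).
Variable al : Broot n.
Hypothesis alE : val al = wt n 0 + wt n I.

Lemma cls_k : has_cls k in_k.
Proof. by move=> a c; rewrite sr_pset /in_k [X in _ || X]andbC orbb. Qed.

Lemma cls_al : has_cls [set al] (symm in_al).
Proof.
have p0I : posp n 0 I by rewrite /posp; lia.
move=> a c; rewrite (sr_set1 _ _ p0I alE) /same_pair /symm /in_al !clsE // /posp; lia.
Qed.

Lemma cls_l : has_cls l (symm in_l).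
Proof. by move=> a c; rewrite sr_l_set. Qed.

Lemma cls_s : has_cls s (fun c d => ~~ symm in_a c d).
Proof. by move=> a c; rewrite sr_s_set. Qed.

Lemma cls_b : has_cls b in_b.
Proof. by move=> a c; rewrite sr_b_set. Qed.

Lemma cls_ob : has_cls ob (symm in_ob).
Proof. by move=> a c; rewrite sr_ob_set. Qed.

Lemma cls_kob : has_cls kob (fun c d => in_b c d && ~~ symm in_lev c d).
Proof. by move=> a c; rewrite sr_kob_set. Qed.

Ltac get_cls := first
  [ exact: cls_k | exact: cls_al | exact: cls_l | exact: cls_s | exact: cls_b
  | exact: cls_ob | exact: cls_kob | exact: has_clsT
  | apply: has_clsU; get_cls | apply: has_clsI; get_cls | apply: has_clsD; get_cls ].

Ltac by_cls := apply: cls_stableP; [get_cls | get_cls | by vm_compute].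

Lemma setT_stable : add_stable [set: Broot n] setT. Proof. by_cls. Qed.
Lemma s_stable : add_stable s s. Proof. by_cls. Qed.
Lemma k_stable : add_stable k setT. Proof. by_cls. Qed.
Lemma ks_stable : add_stable k s. Proof. by_cls. Qed.
Lemma alk_stable : add_stable (al |: k) setT. Proof. by_cls. Qed.
Lemma lk_stable : add_stable (l :|: k) s. Proof. by_cls. Qed.
Lemma lkD_stable : add_stable (l :|: k) (l :|: k). Proof. by_cls. Qed.
Lemma allk_stable : add_stable (al |: (l :|: k)) s. Proof. by_cls. Qed.
Lemma allkD_stable : add_stable (al |: (l :|: k)) (al |: (l :|: k)). Proof. by_cls. Qed.
Lemma al_stable : add_stable [set al] [set al]. Proof. by_cls. Qed.
(** Once a(alpha) is removed, alpha is no longer a sum of two roots of s. This yields the direct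
    factor X_alpha in (a). *)
Lemma sal_stable : add_stable (s :\ al) s. Proof. by_cls. Qed.
Lemma salD_stable : add_stable (s :\ al) (s :\ al). Proof. by_cls. Qed.
Lemma b_stable : add_stable b b. Proof. by_cls. Qed.
Lemma bk_stable : add_stable (b :&: k) b. Proof. by_cls. Qed.
Lemma b_allk_stable : add_stable (b :|: (al |: (l :|: k))) (b :|: (al |: (l :|: k))).
Proof. by_cls. Qed.
Lemma obD_stable : add_stable ob ob. Proof. by_cls. Qed.
Lemma ob_allk_stable : add_stable (ob :|: (al |: (l :|: k))) (ob :|: (al |: (l :|: k))).
Proof. by_cls. Qed.
Lemma ob_stable : add_stable ob (b :|: ob). Proof. by_cls. Qed.
Lemma b_ob_stable : add_stable (b :|: ob) (b :|: ob). Proof. by_cls. Qed.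
Lemma kob_stable : add_stable kob b. Proof. by_cls. Qed.
Lemma kobD_stable : add_stable kob kob. Proof. by_cls. Qed.
Lemma kobob_stable : add_stable (kob :|: ob) (kob :|: ob). Proof. by_cls. Qed.
Lemma kob_ob_stable : add_stable kob (kob :|: ob). Proof. by_cls. Qed.
Lemma ob_kob_stable : add_stable ob (kob :|: ob). Proof. by_cls. Qed.

Ltac eq_cls := apply: has_cls_eq; [get_cls | get_cls | by vm_compute].
Ltac sub_cls := apply: has_cls_sub; [get_cls | get_cls | by vm_compute].

Lemma lk_sub_s : l :|: k \subset s. Proof. sub_cls. Qed.
Lemma k_sub_s : k \subset s. Proof. sub_cls. Qed.
Lemma allk_sub_s : al |: (l :|: k) \subset s. Proof. sub_cls. Qed.
Lemma lk_sub_sal : l :|: k \subset s :\ al. Proof. sub_cls. Qed.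
Lemma salI_allk : (s :\ al) :&: (al |: (l :|: k)) = l :|: k. Proof. eq_cls. Qed.
Lemma salU_al : (s :\ al) :|: [set al] = s. Proof. eq_cls. Qed.
Lemma alI_lk : [set al] :&: (l :|: k) = set0.
Proof.
apply/setP=> g; rewrite !inE; apply: contraTF isT => /andP[/eqP-> alk].
have := subsetP lk_sub_sal al; rewrite !inE eqxx; exact.
Qed.
Lemma b_sub_s : b \subset s. Proof. sub_cls. Qed.
Lemma ob_sub_s : ob \subset s. Proof. sub_cls. Qed.
Lemma sE : s = (b :|: ob) :|: (al |: (l :|: k)). Proof. eq_cls. Qed.
Lemma allkI_b : (al |: (l :|: k)) :&: b = b :&: k. Proof. eq_cls. Qed.
Lemma obI_k : ob :&: k = set0.
Proof. by apply: sr_eq => a c pac; rewrite sr_setI sr_set0 cls_ob cls_k pac /= /symm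
   /in_ob /in_k; case: (cls n I a) => [|[|[|[|[|]]]]]; case: (cls n I c) => [|[|[|[|[|]]]]]. Qed.
Lemma allkI_ob : (al |: (l :|: k)) :&: ob = set0.
(* The empty set is replaced by [ob :&: k], which has a description by classes. *)
Proof. rewrite -obI_k; eq_cls. Qed.
Lemma b_ob_allk : (ob :|: (al |: (l :|: k))) :&: (b :|: (al |: (l :|: k))) = al |: (l :|: k).
Proof. eq_cls. Qed.
Lemma kobI_ob : kob :&: ob = set0.
Proof. rewrite -obI_k; eq_cls. Qed.
Lemma kob_bk : kob :|: (k :&: b) = kob. Proof. eq_cls. Qed.
Lemma kob_sub_b : kob \subset b. Proof. sub_cls. Qed.

(** Lowering c to d adds the positive root {2n - c, d}. The last two conditions say that {a, d} and
    {2n - c, d} are pairs of distinct positions. *)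
Lemma normal_step (M : {set Broot n}) a c d : add_stable M setT -> sr M a c ->
  (d < c)%N -> a != d -> (c + d)%N != n.*2 -> sr M a d.
Proof.
move=> nM sac dc ad cd; have := sr_posp sac; rewrite /posp => /andP[_ ac].
by apply: nM sac _ _; rewrite ?sr_setT /posp; lia.
Qed.

(** Outside k some position of the pair is at least I. Lowering positions with [normal_step] then
    leads to {0, I}, which is alpha. *)
Lemma normal_al (M : {set Broot n}) a c : add_stable M setT -> sr M a c ->
  ~~ in_k (cls n I a) (cls n I c) -> al \in M.
Proof.
move=> nM; have p0I : posp n 0 I by rewrite /posp; lia.
rewrite -(sr_root _ p0I alE) /in_k !cls_lt2 // => sac nk.
wlog cI : a c sac nk / (I <= c)%N => [W|].
  have [cI|cI] := leqP I c; first exact: W nk cI.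
  by apply: (W c a); rewrite 1?srC // 1?andbC //; move: nk; rewrite cI andbT -leqNgt.
have withI d : sr M d I -> sr M 0 I.
  have [->//|d0] := posnP d; rewrite srC => sId; rewrite srC.
  by apply: (normal_step nM sId) => //; [lia | have := sr_posp sId; rewrite /posp; lia].
have := sr_posp sac; rewrite /posp => /andP[nac ac].
have [cE|cE] := eqVneq c I; first by rewrite cE in sac; apply: withI sac.
have [aE|aE] := eqVneq a I.
  rewrite srC -aE; apply: (normal_step nM sac); lia.
have [cE'|cE'] := eqVneq (c + I)%N n.*2; last first.
  by apply/withI/(normal_step nM sac); lia.
(* Here c = 2n - I, and {2n - c, I} = {I, I} is no root, so the descent goes through {0, n}. *)
have s0c : sr M 0 c.
  have [<-//|a0] := posnP a; rewrite srC; rewrite srC in sac.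
  by apply: (normal_step nM sac); lia.
have s0n : sr M 0 n by apply: (normal_step nM s0c); lia.
by apply: (normal_step nM s0n); lia.
Qed.

Lemma alNk : al \notin k.
Proof.
have p0I : posp n 0 I by rewrite /posp; lia.
by rewrite -(sr_root _ p0I alE) cls_k /in_k !cls_lt2 // ltnn andbF andbF.
Qed.

(** The set k of all e_r + e_s with r < s < i is normal and misses alpha; by [normal_al] a normal
    subset with any other root contains alpha. *)
Lemma kset_eq : kset al = k.
Proof.
have [/normal_inP[_ _ nk] alk maxk] := kset_max al.
apply/eqP; rewrite eqEsubset; apply/andP; split; last first.
  apply: maxk alNk; apply/normal_inP; split; [|exact: subsetT|exact: k_stable].
  exact: setT_stable.
apply/sr_sub=> a c sac; rewrite cls_k (sr_posp sac) /=.
by apply: contraNT alk; apply: normal_al nk sac.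
Qed.

(** For [I <= 2] every root of k is {0, c} with c < I, hence arises from alpha = {0, I} by one
    lowering. *)
Lemma nset_eq : (I <= 2)%N -> nset al = k.
Proof.
move=> I2; have [/normal_inP[_ _ nn] minn] := nset_min al.
have alNn : al \notin nset al by rewrite /nset !inE eqxx.
apply/eqP; rewrite eqEsubset; apply/andP; split.
  have : al |: nset al \subset al |: k.
    apply: minn (setU11 _ _); apply/normal_inP; split; [|exact: subsetT|exact: alk_stable].
    exact: setT_stable.
  move=> /subsetP H; apply/subsetP=> g gn; have := H g (setU1r _ gn).
  by rewrite in_setU1 => /orP[/eqP gal|//]; rewrite gal (negPf alNn) in gn.
have p0I : posp n 0 I by rewrite /posp; lia.
have s0I : sr (al |: nset al) 0 I by rewrite (sr_root _ p0I alE) setU11.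
have step a c : sr k a c -> (a < c)%N -> sr (nset al) a c.
  move=> sac ac; have : sr (al |: nset al) a c.
    move: sac; rewrite cls_k /in_k !cls_lt2 // => /and3P[_ aI cI].
    by have -> : a = 0%N by [lia]; apply: (normal_step nn s0I); lia.
  rewrite sr_setU => /orP[|//] sal; move: sac; rewrite cls_k /in_k !cls_lt2 //.
  by move: sal; rewrite (sr_set1 _ _ p0I alE) /same_pair; lia.
apply/sr_sub=> a c sac; have [ac|ac|ac] := ltngtP a c; first exact: step.
  by rewrite srC step // srC.
by have := sr_posp sac; rewrite /posp ac eqxx.
Qed.

Lemma kob_eq_b : (I <= 2)%N -> kob = b.
Proof.
move=> I2; apply: sr_eq => a c pac; rewrite cls_kob cls_b pac /=.
rewrite /symm /in_lev !clsE //; case: (in_b _ _) => //=.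
by move: pac; rewrite /posp; lia.
Qed.

End Patterns.

(** * Root vectors and orthogonal unitriangular matrices *)

Section RootVector.
Variables (F : finFieldType) (n : nat).
Notation E := (@delta_mx F n.*2.+1 n.*2.+1).
Notation rv := (@root_vector F n).

Lemma sum_nat_pick (V : nmodType) (m p x : nat) (P : pred nat) (c : bool) (G : nat -> V) :
    (m <= x < p)%N -> (forall i, (m <= i < p)%N -> P i = (i == x) && c) ->
  \sum_(m <= i < p | P i) G i = if c then G x else 0.
Proof.
move=> xin PE; rewrite big_mkcond.
rewrite (eq_big_nat _ _ (F2 := fun i => if i == x then if c then G i else 0 else 0)).
  by rewrite -big_mkcond big_nat1_eq xin.
by move=> i /PE ->; case: (i == x).
Qed.

Lemma sum_nat_none (V : nmodType) (m p : nat) (P : pred nat) (G : nat -> V) :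
    (forall i, (m <= i < p)%N -> P i = false) ->
  \sum_(m <= i < p | P i) G i = 0.
Proof.
by move=> P0; rewrite big_nat_cond big1 // => i /andP[/P0->].
Qed.

Lemma root_vectorE a c : (a < c)%N -> posp n a c ->
  rv (wt n a + wt n c) =
    E (inord a) (inord (n.*2 - c)) *+ (c == n).+1 - E (inord c) (inord (n.*2 - a)).
Proof.
move=> ac pac; have [an cn] := posp_le pac.
have e1 i : (1 <= i < n.+1)%N ->
    (wt n a + wt n c == e n i) = (i == a.+1) && (c == n).
  move=> ilt; rewrite e_wtn; last by lia.
  by rewrite mem_wt1 //; move: pac; rewrite /posp /same_pair; lia.
have e2 i j : (1 <= i < n.+1)%N -> (i.+1 <= j < n.+1)%N ->
    (wt n a + wt n c == e n i - e n j) = (i == a.+1) && ((j == (n.*2 - c).+1) && (n < c)%N).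
  move=> ilt jlt; rewrite e_wtB; try lia.
  by rewrite mem_wt1 //; move: pac; rewrite /posp /same_pair; lia.
have e3 i j : (1 <= i < n.+1)%N -> (i.+1 <= j < n.+1)%N ->
    (wt n a + wt n c == e n i + e n j) = (i == a.+1) && ((j == c.+1) && (c < n)%N).
  move=> ilt jlt; rewrite e_wtD; try lia.
  by rewrite mem_wt1 //; move: pac; rewrite /posp /same_pair; lia.
have an1 : (1 <= a.+1 < n.+1)%N by move: pac; rewrite /posp; lia.
rewrite /root_vector (sum_nat_pick _ an1 e1).
rewrite [X in _ + X + _](_ : _ = if (n < c)%N
  then E (inord a) (inord (n.*2 - c)) - E (inord c) (inord (n.*2 - a)) else 0); last first.
  rewrite (eq_big_nat _ _ (F2 := fun i => if i == a.+1 then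
     if (n < c)%N then E (inord a) (inord (n.*2 - c)) - E (inord c) (inord (n.*2 - a)) else 0
     else 0)); first by rewrite -big_mkcond big_nat1_eq an1.
  move=> i ilt; case: eqP => [ia|/eqP/negPf ia]; last first.
    by apply: sum_nat_none => j jlt; rewrite e2 // ia.
  have [nc|nc] := ltnP n c; last first.
    by apply: sum_nat_none => j jlt; rewrite e2 // ltnNge nc !andbF.
  rewrite (@sum_nat_pick _ _ _ (n.*2 - c).+1 _ (n < c)%N).
  - by rewrite nc ia subn1 /= subn1 subSS /= subSS subKn.
  - by move: pac; rewrite /posp; lia.
  by move=> j jlt; rewrite e2 // ia eqxx.
rewrite [X in _ + _ + X](_ : _ = if (c < n)%N
  then E (inord a) (inord (n.*2 - c)) - E (inord c) (inord (n.*2 - a)) else 0); last first.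
  rewrite (eq_big_nat _ _ (F2 := fun i => if i == a.+1 then
     if (c < n)%N then E (inord a) (inord (n.*2 - c)) - E (inord c) (inord (n.*2 - a)) else 0
     else 0)); first by rewrite -big_mkcond big_nat1_eq an1.
  move=> i ilt; case: eqP => [ia|/eqP/negPf ia]; last first.
    by apply: sum_nat_none => j jlt; rewrite e3 // ia.
  have [nc|nc] := ltnP c n; last first.
    by apply: sum_nat_none => j jlt; rewrite e3 // ltnNge nc !andbF.
  rewrite (@sum_nat_pick _ _ _ c.+1 _ (c < n)%N).
  - by rewrite nc ia !subn1 /= !subSS.
  - by move: pac; rewrite /posp; lia.
  by move=> j jlt; rewrite e3 // ia eqxx.
rewrite !subn1 /= !subSS.
have [cn1|cn1|cn1] := ltngtP c n; rewrite ?add0r ?addr0 ?mulr1n //.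
by rewrite cn1 -addnn addnK.
Qed.
End RootVector.

(** * Supports of matrices, the invariant form and root elements *)

Section Supports.

Variables (F : finFieldType) (N : nat).
Implicit Types (A B M : 'M[F]_N) (R : rel 'I_N).

Definition supp R A := forall x y, A x y != 0 -> R x y.

Lemma suppD R A B : supp R A -> supp R B -> supp R (A + B).
Proof.
move=> RA RB x y; rewrite mxE; case: (eqVneq (A x y) 0) => [->|/RA//].
by rewrite add0r => /RB.
Qed.

Lemma suppN R A : supp R A -> supp R (- A).
Proof. by move=> RA x y; rewrite mxE oppr_eq0 => /RA. Qed.

Lemma suppB R A B : supp R A -> supp R B -> supp R (A - B).
Proof. by move=> RA RB; apply/suppD/suppN. Qed.

Lemma suppZ R a A : supp R A -> supp R (a *: A).
Proof. by move=> RA x y; rewrite mxE mulf_eq0 negb_or => /andP[_ /RA]. Qed.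

Lemma suppM R R' R'' A B :
    (forall x y z, R x y -> R' y z -> R'' x z) ->
  supp R A -> supp R' B -> supp R'' (A *m B).
Proof.
move=> RR RA RB x z; rewrite mxE => nz.
have [y /andP[Axy Byz]|no] := pickP (fun y => (A x y != 0) && (B y z != 0)).
  exact: RR (RA _ _ Axy) (RB _ _ Byz).
case/eqP: nz; apply: big1 => y _; have /nandP[] := negbT (no y);
  by rewrite negbK => /eqP->; rewrite ?mul0r ?mulr0.
Qed.

Lemma supp_sub R R' A : (forall x y, R x y -> R' x y) -> supp R A -> supp R' A.
Proof. by move=> RR RA x y /RA/RR. Qed.

Lemma supp_eq0 R A x y : supp R A -> ~~ R x y -> A x y = 0.
Proof. by move=> RA nR; apply/eqP; apply: contraNT nR => /RA. Qed.

Lemma mul_unip A M : A *m M - 1%:M = (A - 1%:M) *m (M - 1%:M) + (A - 1%:M + (M - 1%:M)).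
Proof.
rewrite -{1}[A](subrK 1%:M) -{1}[M](subrK 1%:M); move: (A - _) (M - _) => a m.
by rewrite mulmxDl mul1mx mulmxDr mulmx1 addrA addrK -addrA.
Qed.

Definition htr (h : nat) : rel 'I_N := fun x y => (x + h <= y)%N.

Lemma htrM h h' A B : supp (htr h) A -> supp (htr h') B -> supp (htr (h + h')) (A *m B).
Proof. by apply: suppM => x y z; rewrite /htr; lia. Qed.

End Supports.

Section Form.

Variables (F : finFieldType) (n : nat).
Notation N := (n.*2.+1).
Notation GL := {'GL_N[F]}.
Implicit Types (x y z : 'I_N) (A M : 'M[F]_N) (R : rel 'I_N) (g : GL).

(** Coefficients of the polar form of the quadratic form: the square x_0^2 contributes 2 at the
    middle position, each hyperbolic pair 1. *)
Definition dcoef x : F := (x == n :> nat).+1%:R.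

Lemma rev_nat x : rev_ord x = (n.*2 - x)%N :> nat.
Proof. by rewrite /= subSS. Qed.

Lemma dcoef_rev x : dcoef (rev_ord x) = dcoef x.
Proof.
by rewrite /dcoef rev_nat; congr (_%:R); have := ltn_ord x; lia.
Qed.

Definition Gram : 'M[F]_N := \matrix_(x, y) ((y == rev_ord x)%:R * dcoef x).

Lemma form_mulE A x y : (Gram *m A) x y = dcoef x * A (rev_ord x) y.
Proof.
rewrite mxE (bigD1 (rev_ord x)) //= big1 => [|z /negPf zx].
  by rewrite mxE eqxx mul1r addr0.
by rewrite mxE zx !mul0r.
Qed.

Lemma mul_formE (r : nat) (A : 'M[F]_(r, N)) (x : 'I_r) y :
  (A *m Gram) x y = A x (rev_ord y) * dcoef y.
Proof.
rewrite mxE (bigD1 (rev_ord y)) //= big1 => [|z zy].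
  by rewrite mxE rev_ordK eqxx mul1r addr0 dcoef_rev.
rewrite mxE; have -> : (y == rev_ord z) = false.
  by apply: contraNF zy => /eqP->; rewrite rev_ordK.
by rewrite mul0r mulr0.
Qed.

Definition patt R : {set GL} :=
  [set g : GL | ((GLval g)^T *m Gram *m GLval g == Gram) &&
           [forall x, forall y, ((GLval g - 1%:M) x y != 0) ==> R x y]].

Lemma pattP R (g : GL) :
  reflect ((GLval g)^T *m Gram *m GLval g = Gram /\ supp R (GLval g - 1%:M))
          (g \in patt R).
Proof.
rewrite inE; apply: (iffP andP) => [[/eqP-> /forallP H]|[-> H]]; split=> //.
  by move=> x y; apply/implyP; move/forallP: (H x); apply.
by apply/forallP=> x; apply/forallP=> y; apply/implyP/H.
Qed.

Lemma patt_group_set R : transitive R -> group_set (patt R).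
Proof.
move=> Rtr; apply/group_setP; split.
  apply/pattP; rewrite GL_1E trmx1 mul1mx mulmx1; split=> // x y.
  by rewrite subrr mxE eqxx.
move=> g h /pattP[og sg] /pattP[oh sh]; apply/pattP; rewrite GL_MxE; split.
  by rewrite -[RHS]oh -[in RHS]og trmx_mul !mulmxA.
rewrite mul_unip; apply: suppD; last exact: suppD.
by apply: suppM sg sh => x y z; apply: Rtr.
Qed.

Hypothesis two_neq0 : 2%:R != 0 :> F.

Lemma dcoef_neq0 (x : 'I_N) : dcoef x != 0.
Proof.
by rewrite /dcoef; case: (nat_of_ord x == n); [exact: two_neq0 | exact: oner_neq0].
Qed.

End Form.

Section Positions.

Variable n : nat.
Notation N := (n.*2.+1).
Implicit Types (x y z : 'I_N) (S : {set Broot n}).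

(* The positions of the nonzero entries of the root vectors of S. *)
Definition Nr S : rel 'I_N := fun x y => sr S x (n.*2 - y).

Lemma Nr_lt S x y : Nr S x y -> (x < y)%N.
Proof. by move/sr_posp; rewrite /posp; have := ltn_ord y; lia. Qed.

Lemma Nr_mirror S x y : Nr S (rev_ord y) (rev_ord x) = Nr S x y.
Proof. by rewrite /Nr srC !rev_nat subKn // -ltnS. Qed.

End Positions.

Section RootElements.

Variables (F : finFieldType) (n : nat).
Notation N := (n.*2.+1).
Notation GL := {'GL_N[F]}.
Notation rv := (@root_vector F n).
Implicit Types (x y z : 'I_N) (A M : 'M[F]_N) (S : {set Broot n}) (g h : Broot n).
Hypothesis two_neq0 : 2%:R != 0 :> F.

Lemma ord_root g : exists a c : 'I_N,
  [/\ (a < c)%N, posp n a c, val g = wt n a + wt n c &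
      rv (val g) = dcoef F c *: delta_mx a (rev_ord c) - delta_mx c (rev_ord a)].
Proof.
have [a [c [ac pac gE]]] := BrootP g; have [an cn] := posp_le pac.
have [aN cN] : (a < N)%N /\ (c < N)%N by [].
exists (Ordinal aN), (Ordinal cN); split=> //.
rewrite gE root_vectorE // /dcoef scaler_nat.
have iE m (mN : (m < N)%N) : inord m = Ordinal mN by apply/val_inj; rewrite /= inordK.
have rE m (mN : (m < N)%N) : inord (n.*2 - m) = rev_ord (Ordinal mN) :> 'I_N.
  by apply/val_inj; rewrite /= inordK ?subSS // ltnS leq_subr.
by rewrite (rE _ cN) (rE _ aN) (iE _ aN) (iE _ cN).
Qed.

(** In the square only the product through the middle survives, for c = n. It lies at the mirror
    position (a, rev a), and a third factor kills it. *)
Lemma rv_cube g : rv (val g) *m rv (val g) *m rv (val g) = 0.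
Proof.
have [a [c [ac pac _ ->]]] := ord_root g; move: pac; rewrite /posp => /andP[_ acn].
have r1 : (rev_ord c == a) = false by rewrite -val_eqE /= subSS; lia.
have r2 : (rev_ord a == a) = false by rewrite -val_eqE /= subSS; lia.
have r3 : (rev_ord a == c) = false by rewrite -val_eqE /= subSS; lia.
rewrite mulmxBl !mulmxBr -!scalemxAl -!scalemxAr !mul_delta_mx_cond r1 r2 r3.
rewrite !mulr0n !scaler0 !subr0 sub0r !mulNmx -!scalemxAl mulrb.
case: ifP => _; last by rewrite !mul0mx !scaler0 oppr0 scaler0 subr0.
by rewrite !mul_delta_mx_cond r2 r3 !mulr0n !scaler0 oppr0 scaler0 subr0.
Qed.

(** Root vectors lie in the Lie algebra of the form; hence root elements are orthogonal, as
    [xr_patt] shows. *)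
Lemma rv_skew g : (rv (val g))^T *m Gram F n = - (Gram F n *m rv (val g)).
Proof.
have [a [c [ac pac _ ->]]] := ord_root g; move: pac; rewrite /posp => /andP[_ acn].
have da : dcoef F a = 1 by rewrite /dcoef; have -> : (a == n :> nat) = false by lia.
apply/matrixP=> x y; rewrite mul_formE [RHS]mxE form_mulE !mxE.
have eqr (u v : 'I_N) : (rev_ord u == v) = (u == rev_ord v).
  by apply/eqP/eqP => [<-|->]; rewrite rev_ordK.
rewrite !eqr [(x == rev_ord a) && _]andbC [(x == rev_ord c) && _]andbC.
have ne : (a == c) = false by rewrite -val_eqE /= ltn_eqF.
have [/andP[/eqP-> /eqP->]|_] := boolP ((y == rev_ord a) && (x == rev_ord c)).
  by rewrite !(inj_eq rev_ord_inj) ne /= !dcoef_rev da; ring.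
have [/andP[/eqP-> /eqP->]|_] := boolP ((y == rev_ord c) && (x == rev_ord a)).
  by rewrite !dcoef_rev da /=; ring.
by rewrite /=; ring.
Qed.

Lemma root_eltD g (s t : F) : root_elt g s *m root_elt g t = root_elt g (s + t).
Proof.
have X3 := rv_cube g; rewrite /root_elt.
move: (rv (val g)) X3 => X X3; have X3' : X *m (X *m X) = 0 by rewrite mulmxA.
rewrite !mulmxDl !mulmxDr !mul1mx !mulmx1 -!scalemxAl -!scalemxAr X3 X3'.
rewrite mulmxA X3 mul0mx !scaler0 !addr0 !scalerA.
rewrite scalerDl -!addrA; congr (_ + _).
rewrite [_ + (t *: X + _)]addrCA; congr (_ + _).
rewrite addrCA; congr (_ + _).
rewrite -!scalerDl; congr (_ *: _); field.
exact: two_neq0.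
Qed.

Lemma root_elt0 g : root_elt g 0 = 1%:M :> 'M[F]_N.
Proof. by rewrite /root_elt expr0n mul0r !scale0r !addr0. Qed.

Lemma root_elt_unit g (t : F) : root_elt g t \is a @GRing.unit 'M[F]_N.
Proof.
have /mulmx1_unit[] : root_elt g t *m root_elt g (- t) = 1%:M.
  by rewrite root_eltD subrr root_elt0.
by [].
Qed.

Definition xr g (t : F) : GL := FinRing.unit _ (root_elt_unit g t).

Lemma xrE g (t : F) : GLval (xr g t) = root_elt g t. Proof. by []. Qed.

Lemma xrD g s t : (xr g s * xr g t)%g = xr g (s + t).
Proof. by apply: val_inj; exact: root_eltD. Qed.

Lemma xr0 g : xr g 0 = 1%g.
Proof. by apply: val_inj; exact: root_elt0. Qed.

Lemma XP (g : Broot n) (x : GL) : reflect (exists t, x = xr g t) (x \in X F g).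
Proof.
rewrite inE; apply: (iffP existsP) => [[t /eqP xE]|[t ->]]; exists t => //.
by apply: val_inj; exact: xE.
Qed.

Lemma mem_X g t : xr g t \in X F g. Proof. by apply/XP; exists t. Qed.

Lemma X_sub_P S g : g \in S -> X F g \subset P F S.
Proof. by move=> gS; exact: subset_trans (bigcup_sup g gS) (subset_gen _). Qed.

Lemma mem_P S g t : g \in S -> xr g t \in P F S.
Proof. by move=> /X_sub_P/subsetP; apply; exact: mem_X. Qed.

Lemma P_sub S (G : {group GL}) :
  (forall g t, g \in S -> xr g t \in G) -> P F S \subset G.
Proof.
move=> H; rewrite gen_subG; apply/bigcupsP=> g gS; apply/subsetP=> x /XP[t ->].
exact: H.
Qed.

Lemma PS S S' : S \subset S' -> P F S \subset P F S'.
Proof. by move=> /subsetP sSS; apply: P_sub => g t /sSS; apply: mem_P. Qed.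

Lemma P_set0 : P F set0 = 1%g :> {set GL}.
Proof. by apply/eqP; rewrite -subG1; apply: P_sub => g t; rewrite inE. Qed.

Lemma PU S S' : P F (S :|: S') = (P F S <*> P F S')%g :> {set GL}.
Proof.
apply/eqP; rewrite eqEsubset; apply/andP; split.
  apply: P_sub => g t; rewrite inE => /orP[] gS.
    by apply: (subsetP (joing_subl _ _)); exact: mem_P.
  by apply: (subsetP (joing_subr _ _)); exact: mem_P.
by rewrite join_subG !PS ?subsetUl ?subsetUr.
Qed.

Lemma P_set1 g : P F [set g] = X F g :> {set GL}.
Proof.
have gX : group_set (X F g).
  apply/group_setP; split; first by apply/XP; exists 0; rewrite xr0.
  by move=> _ _ /XP[s ->] /XP[t ->]; apply/XP; exists (s + t); rewrite xrD.
apply/eqP; rewrite eqEsubset X_sub_P ?set11 // andbT.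
by apply: (@P_sub _ (Group gX)) => h t; rewrite inE => /eqP->; exact: mem_X.
Qed.

Lemma supp_rv S g : g \in S -> supp (Nr S) (rv (val g)).
Proof.
move=> gS; have [a [c [ac pac gE ->]]] := ord_root g.
have sac : sr S a c by rewrite (sr_root _ pac gE).
apply: suppB; first apply: suppZ.
  move=> x y; rewrite mxE; case: (boolP (_ && _)) => [/andP[/eqP-> /eqP->] _|].
    by rewrite /Nr rev_nat subKn // -ltnS.
  by rewrite eqxx.
move=> x y; rewrite mxE; case: (boolP (_ && _)) => [/andP[/eqP-> /eqP->] _|].
  by rewrite /Nr rev_nat subKn 1?srC // -ltnS.
by rewrite eqxx.
Qed.

(** Short roots have an entry 2, so odd characteristic matters here. [clear_lowest] divides by such
    an entry. *)
Lemma rv_neq0 g x y : Nr [set g] x y -> rv (val g) x y != 0.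
Proof.
have [a [c [ac pac gE ->]]] := ord_root g.
have [_ yE] : (n.*2 - y)%N = rev_ord y /\ rev_ord (rev_ord y) = y.
  by rewrite rev_nat rev_ordK.
rewrite /Nr (sr_set1 _ _ pac gE) /same_pair -rev_nat.
case/orP=> /andP[/eqP/val_inj xE /eqP/val_inj yE'].
  rewrite -yE yE' xE !mxE !eqxx mulr1.
  have -> : (a == c) = false by rewrite -val_eqE /= ltn_eqF.
  by rewrite subr0 (dcoef_neq0 two_neq0).
rewrite -yE yE' xE !mxE !eqxx.
have -> : (c == a) = false by rewrite -val_eqE /= gtn_eqF.
by rewrite mulr0 sub0r oppr_eq0 oner_eq0.
Qed.

End RootElements.

(** * Entries of pattern groups *)

Section Chains.

Variable n : nat.
Notation N := (n.*2.+1).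
Implicit Types (x y z t : 'I_N) (S : {set Broot n}).

Variables M S : {set Broot n}.

Lemma Nr_sub x y : M \subset S -> Nr M x y -> Nr S x y.
Proof. by move=> /sr_sub; apply. Qed.

Hypothesis M_stable : add_stable M S.

Lemma Nr_compl x y z : Nr M x y -> Nr S y z -> (x + z)%N != n.*2 -> Nr M x z.
Proof.
move=> xy yz xz; have [lxy lyz] := (Nr_lt xy, Nr_lt yz).
apply: M_stable xy _ _; first by rewrite subKn // -ltnS.
by rewrite /posp; have := ltn_ord z; lia.
Qed.

Lemma Nr_compr x y z : Nr S x y -> Nr M y z -> (x + z)%N != n.*2 -> Nr M x z.
Proof.
move=> xy yz xz; rewrite -Nr_mirror; apply: (@Nr_compl _ (rev_ord y)).
- by rewrite Nr_mirror.
- by rewrite Nr_mirror.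
by rewrite !rev_nat; move: (ltn_ord x) (ltn_ord z) xz; clear; lia.
Qed.

(* [M] is a normal subset of the closed set [S]: the nonzero entries of P(M)
   lie at positions [chain]. Besides the roots of [M] these include mirror
   positions, whose weights 2e_i are not roots. *)
Definition chain x y := Nr M x y || [exists z, Nr M x z && Nr S z y || Nr S x z && Nr M z y].

Lemma chain_root x y : chain x y -> (x + y)%N != n.*2 -> Nr M x y.
Proof.
move=> /orP[//|/existsP[z /orP[] /andP[xz zy]]].
  exact: Nr_compl xz zy.
exact: Nr_compr xz zy.
Qed.

Lemma chain_lt x y : chain x y -> (x < y)%N.
Proof.
by move=> /orP[/Nr_lt//|/existsP[z /orP[] /andP[/Nr_lt xz /Nr_lt]]]; apply: ltn_trans.
Qed.

(** For three consecutive increasing steps, this says that the first two or the last two compose to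
    a non-mirror position. *)
Lemma not_both_mirror x y z t : (x < y)%N -> (z < t)%N ->
  (x + z != n.*2)%N || (y + t != n.*2)%N.
Proof. by move=> *; lia. Qed.

Lemma chain_Mr x y z : Nr M x y -> Nr S y z -> chain x z.
Proof. by move=> xy yz; apply/orP; right; apply/existsP; exists y; rewrite xy yz. Qed.

Lemma chain_Sr x y z : Nr S x y -> Nr M y z -> chain x z.
Proof. by move=> xy yz; apply/orP; right; apply/existsP; exists y; rewrite xy yz orbT. Qed.
End Chains.

Section ChainTrans.
Variable n : nat.
Notation N := (n.*2.+1).
Implicit Types (x y z t : 'I_N).
Variables M S : {set Broot n}.
Hypotheses (S_closed : add_stable S S) (sMS : M \subset S) (M_stable : add_stable M S).
Notation chainM := (chain M S).
Notation chainS := (chain S S).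

(** A path of three steps has two adjacent steps that compose to a root, so it shortens to two steps
    and [chain] is closed under further composition. *)
Lemma chain_S x y z : chainM x y -> Nr S y z -> chainM x z.
Proof.
move=> /orP[xy yz|/existsP[t /orP[] /andP[xt ty]] yz]; first exact: chain_Mr xy yz.
  have [m|] := boolP (x + y != n.*2)%N.
    exact: chain_Mr (Nr_compl M_stable xt ty m) yz.
  have /orP[->//|m _] := not_both_mirror (Nr_lt xt) (Nr_lt yz).
  exact: chain_Mr xt (Nr_compl S_closed ty yz m).
have [m|] := boolP (x + y != n.*2)%N.
  exact: chain_Mr (Nr_compr M_stable xt ty m) yz.
have /orP[->//|m _] := not_both_mirror (Nr_lt xt) (Nr_lt yz).
exact: chain_Sr xt (Nr_compl M_stable ty yz m).
Qed.

Lemma S_chain x y z : Nr S x y -> chainM y z -> chainM x z.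
Proof.
move=> xy /orP[yz|/existsP[t /orP[] /andP[yt tz]]]; first exact: chain_Sr xy yz.
  have [m|] := boolP (x + t != n.*2)%N.
    exact: chain_Mr (Nr_compr M_stable xy yt m) tz.
  have /orP[->//|m _] := not_both_mirror (Nr_lt xy) (Nr_lt tz).
  exact: chain_Sr xy (Nr_compl M_stable yt tz m).
have [m|] := boolP (x + t != n.*2)%N.
  exact: chain_Sr (Nr_compl S_closed xy yt m) tz.
have /orP[->//|m _] := not_both_mirror (Nr_lt xy) (Nr_lt tz).
exact: chain_Sr xy (Nr_compr M_stable yt tz m).
Qed.

Lemma chain_chainS x y z : chainM x y -> chainS y z -> chainM x z.
Proof.
move=> xy /orP[yz|/existsP[t]]; first exact: chain_S xy yz.
by rewrite orbb => /andP[yt tz]; exact: chain_S (chain_S xy yt) tz.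
Qed.

Lemma chainS_chain x y z : chainS x y -> chainM y z -> chainM x z.
Proof.
move=> /orP[xy|/existsP[t]]; first by move=> yz; exact: S_chain xy yz.
by rewrite orbb => /andP[xt ty] yz; exact: S_chain xt (S_chain ty yz).
Qed.

Lemma chain_sub x y : chainM x y -> chainS x y.
Proof.
move=> /orP[/(Nr_sub sMS) xy|/existsP[t]]; first by rewrite /chain xy.
case/orP=> /andP[xt ty]; apply/orP; right; apply/existsP; exists t; rewrite orbb.
  by rewrite (Nr_sub sMS xt).
by rewrite xt (Nr_sub sMS ty).
Qed.

Lemma chain_trans : transitive chainM.
Proof. by move=> y x z xy yz; exact: chain_chainS xy (chain_sub yz). Qed.
End ChainTrans.

(** * Lowest entries of orthogonal unitriangular matrices *)

Section Lowest.

Variables (F : finFieldType) (n : nat).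
Notation N := (n.*2.+1).
Notation GL := {'GL_N[F]}.
Notation rv := (@root_vector F n).
Implicit Types (x y z u v : 'I_N) (g : GL).

Definition ltr : rel 'I_N := fun x y => (x < y)%N.

Definition lowest g x y : Prop :=
  [/\ (x < y)%N, GLval g x y != 0 &
      forall u v, (u < v)%N -> (v - u < y - x)%N -> GLval g u v = 0].

Lemma unip_entry g x y : x != y -> (GLval g - 1%:M) x y = GLval g x y.
Proof. by move=> /negPf xy; rewrite !mxE xy subr0. Qed.

Lemma lowest_htr g x y : supp ltr (GLval g - 1%:M) -> lowest g x y ->
  supp (@htr N (y - x)) (GLval g - 1%:M).
Proof.
move=> sg [xy _ low] u v nz; have uv := sg _ _ nz; rewrite /ltr in uv.
rewrite /htr; case: leqP => // H; case/eqP: nz.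
rewrite unip_entry ?low // -?val_eqE /=; first by lia.
by rewrite ltn_eqF.
Qed.

Lemma isometry_linearize (G A : 'M[F]_N) : A^T *m G *m A = G ->
  (A - 1%:M)^T *m G *m (A - 1%:M) + G *m (A - 1%:M) + (A - 1%:M)^T *m G = 0.
Proof.
rewrite -{1 2}[A](subrK 1%:M); move: (A - 1%:M) => m.
have -> : (m + 1%:M)^T = m^T + 1%:M by apply/matrixP=> i j; rewrite !mxE eq_sym.
rewrite mulmxDl mul1mx mulmxDr mulmx1 mulmxDl => E.
by apply: (addIr G); rewrite add0r -addrA.
Qed.

(* At lowest height, the orthogonality relation is linear. *)
Lemma lowest_mirror g x y : g \in patt F ltr -> lowest g x y ->
  dcoef F x * GLval g x y + dcoef F y * GLval g (rev_ord y) (rev_ord x) = 0.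
Proof.
move=> /pattP[og sg] lg; have sh := lowest_htr sg lg; have [xy _ low] := lg.
have E := isometry_linearize og.
have := congr1 (fun A : 'M_N => A (rev_ord x) y) E.
rewrite /= [LHS]mxE [X in X + _]mxE [RHS]mxE mul_formE form_mulE rev_ordK dcoef_rev.
have nxy : x != y by rewrite -val_eqE /= ltn_eqF.
rewrite [X in X + _ + _]mxE big1 ?add0r => [<-|z _].
  rewrite [X in _ = _ + X * _]mxE !unip_entry //; last first.
    by rewrite (inj_eq rev_ord_inj) eq_sym.
  by congr (_ + _); exact: mulrC.
(* A nonzero quadratic term would need x < z from its first factor and z + (y - x) <= y from its
   second. *)
rewrite mul_formE [X in X * _ * _]mxE.
have [->|/sg] := eqVneq ((GLval g - 1%:M) (rev_ord z) (rev_ord x)) 0.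
  by rewrite !mul0r.
rewrite /ltr !rev_nat => zx; have [->|/sh] := eqVneq ((GLval g - 1%:M) z y) 0.
  by rewrite mulr0.
rewrite /htr; have := ltn_ord x; have := ltn_ord z; lia.
Qed.

Hypothesis two_neq0 : 2%:R != 0 :> F.

(** At a mirror position the two terms of [lowest_mirror] coincide, and twice a nonzero entry would
    vanish. *)
Lemma lowest_not_mirror g x y : g \in patt F ltr -> lowest g x y ->
  (x + y)%N != n.*2.
Proof.
move=> gU lg; have := lowest_mirror gU lg; have [xy gxy _] := lg.
apply: contra_eqN => /eqP xyE.
have yE : rev_ord x = y by apply: val_inj; rewrite /= subSS; lia.
have xE : rev_ord y = x by rewrite -yE rev_ordK.
rewrite xE yE -mulrDl mulf_eq0 (negPf gxy) orbF -{1}yE dcoef_rev.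
by rewrite -mulr2n -mulr_natl mulf_eq0 (negPf two_neq0) (negPf (dcoef_neq0 two_neq0 _)).
Qed.

Lemma lowest_mirror_neq0 g x y : g \in patt F ltr -> lowest g x y ->
  GLval g (rev_ord y) (rev_ord x) != 0.
Proof.
move=> gU lg; have := lowest_mirror gU lg; have [xy gxy _] := lg.
apply: contra_eqN => /eqP->; rewrite mulr0 addr0 mulf_eq0 (negPf gxy) orbF.
exact: dcoef_neq0.
Qed.

(** The two-step condition on R accounts for the square of the root vector in the exponential. *)
Lemma xr_unip (gm : Broot n) (t : F) (S : {set Broot n}) (R : rel 'I_N) : gm \in S ->
  (forall x y, Nr S x y -> R x y) -> (forall x y z, Nr S x y -> Nr S y z -> R x z) ->
  supp R (GLval (xr two_neq0 gm t) - 1%:M).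
Proof.
move=> gS R1 R2; rewrite xrE /root_elt.
have -> : 1%:M + t *: rv (val gm) + (t ^+ 2 / 2%:R) *: (rv (val gm) *m rv (val gm)) - 1%:M
   = t *: rv (val gm) + (t ^+ 2 / 2%:R) *: (rv (val gm) *m rv (val gm)).
  by rewrite addrAC [1%:M + _]addrC addrK.
have sX := supp_rv (F := F) gS.
by apply: suppD; apply: suppZ; [exact: (supp_sub R1 sX) | exact: (suppM R2 sX sX)].
Qed.

Lemma xr_patt (gm : Broot n) (t : F) (S : {set Broot n}) (R : rel 'I_N) : gm \in S ->
  (forall x y, Nr S x y -> R x y) -> (forall x y z, Nr S x y -> Nr S y z -> R x z) ->
  xr two_neq0 gm t \in patt F R.
Proof.
move=> gS R1 R2; apply/pattP; split; last exact: xr_unip R2.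
rewrite xrE /=; suff -> : (root_elt gm t)^T *m Gram F n = Gram F n *m root_elt gm (- t).
  by rewrite -mulmxA root_eltD // addNr root_elt0 mulmx1.
have sk := rv_skew two_neq0 gm; rewrite /root_elt.
move: (rv _) sk => Y sk; rewrite sqrrN !linearD /= !linearZ /= trmx1 trmx_mul.
rewrite !mulmxDl mul1mx mulmx1 -!scalemxAl -mulmxA sk.
by rewrite scaleNr scalerN mulmxN mulmxA sk mulNmx opprK mulmxA.
Qed.

End Lowest.

Section PatternGroups.

Variables (F : finFieldType) (n : nat).
Notation N := (n.*2.+1).
Notation GL := {'GL_N[F]}.
Notation rv := (@root_vector F n).
Notation ltrN := (@ltr n).
Implicit Types (x y z u v : 'I_N) (g : GL) (S M : {set Broot n}) (G : {group GL}).
Hypothesis two_neq0 : 2%:R != 0 :> F.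
Notation xr := (xr two_neq0).

Lemma GL_unip_eq1 g : g \in patt F ltrN ->
  (forall u v, (u < v)%N -> GLval g u v = 0) -> g = 1%g.
Proof.
move=> /pattP[_ sg] g0; apply: val_inj; apply/eqP; rewrite -subr_eq0; apply/eqP.
apply/matrixP=> u v; rewrite [RHS]mxE; apply/eqP; apply: contraT => nz.
have uv := sg _ _ nz; case/eqP: nz.
by rewrite unip_entry ?g0 // -val_eqE /= ltn_eqF.
Qed.

(* Position (u, v) in the order by height first: clearing the first nonzero
   entry of an element with a root element only affects later positions. *)
Definition pcode u v := ((v - u) * N + u)%N.

Lemma clear_lowest g x y : g \in patt F ltrN -> lowest g x y ->
    (forall u v, (u < v)%N -> (pcode u v < pcode x y)%N -> GLval g u v = 0) ->
  exists (r : Broot n) t, val r = wt n x + wt n (n.*2 - y) /\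
    forall u v, (u < v)%N -> (pcode u v <= pcode x y)%N ->
      GLval (xr r t * g)%g u v = 0.
Proof.
move=> gU lg before; have [xy gxy low] := lg.
have xy2 := lowest_not_mirror two_neq0 gU lg.
have pxy : posp n x (n.*2 - y) by rewrite /posp; have := ltn_ord y; lia.
have [r rE] := ex_root pxy.
have rxy : Nr [set r] x y by rewrite /Nr (sr_root _ pxy rE) set11.
have X0 := rv_neq0 two_neq0 rxy.
pose t := - (GLval g x y / rv (val r) x y); exists r, t; split=> // u v uv le_code.
have hu : (v - u <= y - x)%N.
  rewrite leqNgt; apply/negP=> lt; move: le_code; rewrite /pcode.
  have := ltn_ord x; have : ((y - x).+1 * N <= (v - u) * N)%N by rewrite leq_mul2r lt orbT.
  by rewrite mulSn; lia.
pose h := (y - x)%N; have h0 : (0 < h)%N by rewrite /h subn_gt0.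
have rN u' v' : Nr [set r] u' v' -> (v' - u' = h)%N.
  move=> H; have := Nr_lt H; move: H; rewrite /Nr (sr_set1 _ _ pxy rE) /same_pair.
  have := ltn_ord v'; have := ltn_ord y; rewrite /h; lia.
have sA : supp (@htr N h) (rv (val r)).
  move=> u' v' /(supp_rv (set11 r)) H; have := rN _ _ H; have := Nr_lt H.
  by rewrite /htr; lia.
have sg := lowest_htr (proj2 (elimT (pattP _ _) gU)) lg.
(* Every product of two nilpotent parts has height at least 2h, so up to height h multiplication is
   additive. *)
have entry : GLval (xr r t * g)%g u v = t * rv (val r) u v + GLval g u v.
  have uv' : u != v by rewrite -val_eqE /= ltn_eqF.
  rewrite -unip_entry // GL_MxE mul_unip xrE.
  pose A := rv (val r).
  have -> : root_elt r t - 1%:M = t *: A + (t ^+ 2 / 2%:R) *: (A *m A).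
    by rewrite /root_elt addrAC [1%:M + _]addrC addrK.
  have far (Z : 'M[F]_N) : supp (@htr N (h + h)) Z -> Z u v = 0.
    by move=> sZ; apply: (supp_eq0 sZ); rewrite /htr; move: hu uv h0; rewrite -/h; lia.
  have sA2 : supp (@htr N (h + h)) (A *m A) by exact: (htrM sA sA).
  have sB : supp (@htr N h) (t *: A + (t ^+ 2 / 2%:R) *: (A *m A)).
    apply: suppD; apply: suppZ => //; apply: supp_sub sA2 => u' v'.
    by rewrite /htr; lia.
  rewrite [LHS]mxE [X in X + _ = _]far; last exact: (htrM sB sg).
  rewrite add0r [LHS]mxE unip_entry // [X in X + _ = _]mxE.
  rewrite [X in _ + X + _ = _]far; last exact: suppZ.
  by rewrite addr0 [X in X + _ = _]mxE.
rewrite entry; have [/andP[/eqP ux /eqP vy]|neq] := boolP ((u == x) && (v == y)).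
  by rewrite ux vy /t mulNr divfK // addNr.
have lt_code : (pcode u v < pcode x y)%N.
  rewrite ltn_neqAle le_code andbT; apply: contra neq; rewrite /pcode => /eqP E.
  have uE : u = x :> nat.
    by have := congr1 (modn^~ N) E; rewrite /= !modnMDl !modn_small.
  have vE : (v - u = y - x)%N.
    have := congr1 (divn^~ N) E; rewrite /= !divnMDl // !divn_small ?addn0 //.
  by rewrite -!val_eqE /= uE eqxx /=; move: uv xy vE; rewrite uE; lia.
rewrite before // addr0.
have [->|/(supp_rv (set11 r)) H] := eqVneq (rv (val r) u v) 0; first by rewrite mulr0.
move: (H); rewrite /Nr (sr_set1 _ _ pxy rE) /same_pair => /orP[]/andP[/eqP E1 /eqP E2].
  case/negP: neq; rewrite -!val_eqE /= E1 eqxx /=; move: E2 (ltn_ord v) (ltn_ord y).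
  by clear; lia.
(* Apart from (x, y), the root vector is nonzero only at the mirrored position. Were that position
   earlier, [before] would make the entry of g there vanish, against [lowest_mirror_neq0]. *)
have uE : u = rev_ord y by apply: val_inj; rewrite /= subSS.
have vE : v = rev_ord x by apply: val_inj; rewrite /= subSS -E2;
  move: (ltn_ord v); clear; lia.
have := lowest_mirror_neq0 two_neq0 gU lg; rewrite -uE -vE.
by rewrite before // eqxx.
Qed.

(** Elimination: the first nonzero entry of g sits at a root of S, and multiplying by an element of
    that root subgroup clears it without leaving G. Repeating this reduces g to 1. *)
Lemma P_lowest G S : G \subset patt F ltrN -> P F S \subset G ->
    (forall g x y, g \in G -> lowest g x y -> Nr S x y) ->
  G \subset P F S.
Proof.
move=> sGU sPG lowS; apply/subsetP.
(* All codes are below N * N; positions with code below k are already cleared, and m bounds the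
   number of codes left. *)
suff H m k : (N * N <= k + m)%N -> forall g, g \in G ->
    (forall u v, (u < v)%N -> (pcode u v < k)%N -> GLval g u v = 0) -> g \in P F S.
  by move=> g gG; apply: (H (N * N)%N 0%N).
elim: m k => [|m IHm] k le_k g gG before.
  rewrite (GL_unip_eq1 (subsetP sGU _ gG)) ?group1 // => u v uv.
  apply: before => //; rewrite addn0 in le_k; apply: leq_trans le_k; rewrite /pcode.
  have : ((v - u).+1 * N <= N * N)%N by rewrite leq_mul2r; have := ltn_ord v; lia.
  by rewrite mulSn; have := ltn_ord u; lia.
have [/existsP[x /existsP[y /and3P[xy /eqP kE gxy]]]|no] := boolP
  [exists x : 'I_N, exists y : 'I_N, [&& (x < y)%N, pcode x y == k & GLval g x y != 0]].
  have lg : lowest g x y.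
    split=> // u v uv lt; apply: before => //; rewrite -kE /pcode.
    have := ltn_ord u; have : ((v - u).+1 * N <= (y - x) * N)%N by rewrite leq_mul2r lt orbT.
    by rewrite mulSn; lia.
  rewrite -kE in before.
  have [r [t [rE clr]]] := clear_lowest (subsetP sGU _ gG) lg before.
  have rS : r \in S.
    have := lowS _ _ _ gG lg; rewrite /Nr => sxy.
    by rewrite -(sr_root _ (sr_posp sxy) rE).
  have xS := mem_P two_neq0 t rS.
  rewrite -(groupMl _ xS); apply: (IHm k.+1); first by lia.
    by rewrite groupM // (subsetP sPG).
  by move=> u v uv; rewrite ltnS -kE; apply: clr.
apply: (IHm k.+1) => // [|u v uv]; first by lia.
rewrite ltnS leq_eqVlt => /orP[/eqP kE|]; last exact: before.
apply/eqP; apply: contraNT no => nz; apply/existsP; exists u; apply/existsP; exists v.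
by rewrite uv kE eqxx.
Qed.

End PatternGroups.

(** * Normality, intersections and products of pattern groups *)

Section PatternCalculus.

Variables (F : finFieldType) (n : nat).
Notation N := (n.*2.+1).
Notation GL := {'GL_N[F]}.
Notation ltrN := (@ltr n).
Implicit Types (x y z u v : 'I_N) (g : GL) (S M : {set Broot n}) (G : {group GL}).
Hypothesis two_neq0 : 2%:R != 0 :> F.
Notation xr := (xr two_neq0).

Lemma ltr_trans : transitive ltrN.
Proof. by move=> y x z; apply: ltn_trans. Qed.

Lemma P_ltr S : P F S \subset patt F ltrN.
Proof.
apply: (@P_sub _ _ two_neq0 _ (Group (patt_group_set F ltr_trans))) => g t gS.
apply: (xr_patt _ _ gS) => [x y|x y z]; first exact: Nr_lt.
by move=> /Nr_lt xy /Nr_lt; apply: ltn_trans.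
Qed.

Lemma patt_sub (R R' : rel 'I_N) :
  (forall x y, R x y -> R' x y) -> patt F R \subset patt F R'.
Proof.
move=> RR; apply/subsetP=> g /pattP[og sg]; apply/pattP; split=> //.
exact: supp_sub sg.
Qed.

(** For the harder inclusion, a lowest position is a chain and not a mirror position, hence a root
    of M by [chain_root]; then [P_lowest] applies. *)
Lemma P_chain M S : add_stable S S -> M \subset S -> add_stable M S ->
  P F M = patt F (chain M S) :> {set GL}.
Proof.
move=> cS sMS nM; have tr := chain_trans cS sMS nM.
pose G := Group (patt_group_set F tr).
have sG : P F M \subset G.
  apply: (@P_sub _ _ two_neq0) => g t gM.
  apply: (xr_patt _ _ gM) => [x y xy|x y z xy yz]; first by rewrite /chain xy.
  exact: chain_Mr xy (Nr_sub sMS yz).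
have sGU : G \subset patt F ltrN by apply: patt_sub => x y; apply: chain_lt.
apply/eqP; rewrite eqEsubset sG; apply: (P_lowest two_neq0 sGU sG) => g x y gG lg.
have [xy gxy _] := lg; have xy2 := lowest_not_mirror two_neq0 (subsetP sGU _ gG) lg.
have /pattP[_ sg] := gG; apply: (chain_root nM _ xy2).
by apply: sg; rewrite unip_entry // -val_eqE /= ltn_eqF.
Qed.

Lemma P_entry S g x y : add_stable S S -> g \in P F S ->
  (x < y)%N -> (x + y)%N != n.*2 -> GLval g x y != 0 -> Nr S x y.
Proof.
move=> cS; rewrite (P_chain cS (subxx S) cS) => /pattP[_ sg] xy xy2 gxy.
by apply: (chain_root cS _ xy2); apply: sg; rewrite unip_entry // -val_eqE /= ltn_eqF.
Qed.

Lemma P_lowest_in S g x y : add_stable S S -> g \in P F S -> lowest g x y -> Nr S x y.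
Proof.
move=> cS gS lg; have [xy gxy _] := lg; apply: (P_entry cS gS) => //.
exact: (lowest_not_mirror two_neq0 (subsetP (P_ltr S) _ gS) lg).
Qed.

(** The lowest position of a common element lies in both sets, so [P_lowest] shows that the
    intersection is generated by root subgroups. *)
Lemma PI S S' : add_stable S S -> add_stable S' S' ->
  P F S :&: P F S' = P F (S :&: S').
Proof.
move=> cS cS'; apply/eqP; rewrite eqEsubset subsetI.
rewrite (PS two_neq0 (subsetIl _ _)) (PS two_neq0 (subsetIr _ _)) !andbT.
apply: (P_lowest two_neq0 (G := (P F S :&: P F S')%G)).
- exact: subset_trans (subsetIl _ _) (P_ltr S).
- by rewrite subsetI (PS two_neq0 (subsetIl _ _)) (PS two_neq0 (subsetIr _ _)).
move=> g x y /setIP[gS gS'] lg; rewrite /Nr sr_setI; apply/andP; split.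
  exact: (P_lowest_in cS gS lg).
exact: (P_lowest_in cS' gS' lg).
Qed.

(** Since [g ^ k - 1] is k^-1 (g - 1) k, it is enough that chains of M absorb chains of S on both
    sides. *)
Lemma P_norm M S : add_stable S S -> M \subset S -> add_stable M S ->
  P F S \subset 'N(P F M).
Proof.
move=> cS sMS nM; apply/normsP=> /= h hS.
suff H k : k \in P F S -> P F M :^ k \subset P F M.
  apply/eqP; rewrite eqEsubset H //=; have := H _ (groupVr hS).
  by rewrite sub_conjg invgK.
move=> kS; apply/subsetP=> _ /imsetP[g gM ->].
have gU := subsetP (P_ltr M) _ gM; have kU := subsetP (P_ltr S) _ kS.
pose U := Group (patt_group_set F ltr_trans).
have /pattP[ogk _] : (g ^ k)%g \in U by rewrite groupJ.
rewrite (P_chain cS sMS nM); apply/pattP; split=> //.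
have kVS := groupVr kS.
move: kS kVS; rewrite (P_chain cS (subxx S) cS) => /pattP[_ sk] /pattP[_ skV].
move: gM; rewrite (P_chain cS sMS nM) => /pattP[_ sg].
pose A := GLval g - 1%:M; pose B := GLval k - 1%:M; pose C := GLval k^-1 - 1%:M.
have CB : GLval k^-1 *m GLval k = 1%:M by rewrite -GL_MxE mulVg GL_1E.
have -> : GLval (g ^ k)%g - 1%:M = (C + 1%:M) *m (A *m (B + 1%:M)).
  rewrite /A /B /C !subrK conjgE !GL_MxE mulmxBl mul1mx mulmxBr CB.
  by rewrite mulmxA.
rewrite mulmxDl mul1mx.
have sAB : supp (chain M S) (A *m (B + 1%:M)).
  rewrite mulmxDr mulmx1; apply: suppD => //; apply: (suppM _ sg sk).
  exact: (chain_chainS cS nM).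
apply: suppD => //; apply: (suppM _ skV sAB).
exact: (chainS_chain cS nM).
Qed.

Lemma P_normal M S : add_stable S S -> M \subset S -> add_stable M S ->
  P F M <| P F S.
Proof. by move=> cS sMS nM; rewrite /normal PS //=; apply: P_norm. Qed.

Lemma PU_mul M S S' : add_stable S' S' -> M \subset S' -> S \subset S' ->
  add_stable M S' -> P F (S :|: M) = (P F S * P F M)%g :> {set GL}.
Proof.
move=> cS' sM sS nM; rewrite (PU two_neq0) norm_joinEl //.
by apply: subset_trans (P_norm cS' sM nM); apply: PS.
Qed.

End PatternCalculus.

(** * Quotients and products of abstract groups *)

Section AbstractGroups.

Local Open Scope group_scope.

Lemma normals_TI_cents (gT : finGroupType) (A B : {group gT}) :
    A \subset 'N(B) -> B \subset 'N(A) -> A :&: B = 1 ->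
  A \subset 'C(B).
Proof.
move=> nBA nAB TI; apply/commG1P/trivgP; rewrite -TI.
by rewrite subsetI commg_subl nAB commg_subr.
Qed.

Lemma injm_quotient_isog (gT rT : finGroupType) (D G H : {group gT})
    (f : {morphism D >-> rT}) : 'injm f -> G \subset D -> H <| G ->
  G / H \isog (f @* G) / (f @* H).
Proof.
move=> injf sGD nHG; have sHG := normal_sub nHG.
have -> : f @* H = restrm sGD f @* H by rewrite morphim_restrm (setIidPr sHG).
have -> : f @* G = restrm sGD f @* G by rewrite morphim_restrm setIid.
apply/isogP; exists (quotm_morphism (restrm_morphism sGD f) nHG).
  by rewrite injm_quotm // injm_restrm.
exact: morphim_quotm.
Qed.

Section Groups.

Variable gT : finGroupType.
Implicit Types (S A B H K L Y : {group gT}).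

(** Modulo L, S is the direct product of A and B, where A / L is isomorphic to S / B and B / L to Y.
    For (a), Y is X_alpha and A omits alpha. *)
Lemma quotient_isog_setX S A B L Y : A <| S -> B <| S -> L <| S ->
    A :&: B = L -> A * Y = S -> Y * L = B -> Y :&: L = 1 ->
  S / L \isog setX (S / B) Y.
Proof.
move=> nAS nBS nLS ABL AY YL TI.
have [[[sAS nSA] [sBS nSB]] [sLS nSL]] := (andP nAS, andP nBS, andP nLS).
have sLA : L \subset A by rewrite -ABL subsetIl.
have sLB : L \subset B by rewrite -ABL subsetIr.
have sYB : Y \subset B by rewrite -YL mulG_subl.
have SE : A * B = S.
  apply/eqP; rewrite eqEsubset mul_subG //= -{1}AY; exact: mulgS.
have nA := subset_trans sAS; have nB := subset_trans sBS.
have TIq : A / L :&: B / L = 1 by rewrite -quotientGI // ABL trivg_quotient.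
have cq : B / L \subset 'C(A / L).
  apply: normals_TI_cents; last by rewrite setIC.
    by apply: quotient_norms; exact: nB.
  by apply: quotient_norms; exact: nA.
have dS : (A / L) \x (B / L) = S / L.
  by rewrite dprodE // -quotientMl ?SE //; exact: nA.
apply: (isog_dprod dS (setX_dprod (S / B)%G Y)).
  apply: (isog_trans _ (isog_setX1 _ _)); rewrite /= -SE quotientMidr.
  by have := second_isog (nA _ nSB); rewrite setIC ABL.
apply: (isog_trans _ (isog_set1X _ _)); rewrite /= -YL quotientMidr isog_sym.
apply: (isog_trans (quotient1_isog _)).
by have := second_isog (subset_trans sYB (nB _ nSL)); rewrite setIC TI.
Qed.

(** Elementwise form of the second isomorphism theorem, from which the conjugation action in
    [isog_sdprod_conj] can be computed. *)
Lemma second_isom_coset H B : H \subset 'N(B) ->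
  exists f : {morphism H / (B :&: H) >-> coset_of B},
    [/\ 'injm f, f @* (H / (B :&: H)) = H / B &
        {in H, forall y, f (coset (B :&: H) y) = coset B y}].
Proof.
move=> nBH; have [f injf fE] := second_isom nBH.
exists f; split=> //; first exact: fE.
move=> y yH; have nyBH : y \in 'N(B :&: H).
  by apply: (subsetP (normsI nBH (normG H))).
have nyB := subsetP nBH _ yH; have := fE [set y].
rewrite sub1set quotient_set1 // quotient_set1 // morphim_set1; last exact: mem_quotient.
by move=> /(_ yH)/set1_inj.
Qed.

(** The two embeddings come from the second isomorphism theorem; KB and HB meeting in B makes their
    images meet trivially. *)
Lemma quotient_sdprod_conj S B H H0 K K0 : B <| S -> H \subset S -> K \subset S ->
    H \subset 'N(K) -> B :&: H = H0 -> B :&: K = K0 ->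
    (K * B) :&: (H * B) = B -> K * H * B = S ->
  isog_sdprod_conj (S / B) H H0 K K0.
Proof.
move=> /andP[sBS nSB] sHS sKS nKH BH BK KHB KHS.
have eH0 : H0 = (B :&: H)%G by apply: val_inj.
have eK0 : K0 = (B :&: K)%G by apply: val_inj.
have [nBH nBK] := (subset_trans sHS nSB, subset_trans sKS nSB).
subst H0 K0; have [h [injh him hE]] := second_isom_coset nBH.
have [k [injk kim kE]] := second_isom_coset nBK.
split; rewrite ?normsI ?normG //.
- by rewrite /normal subsetIr normsI ?normG.
- by rewrite /normal subsetIr normsI ?normG.
have TI : K / B :&: H / B = 1.
  rewrite -(quotientMidr B K) -(quotientMidr B H) -(norm_joinEl nBK).
  by rewrite -quotientGI ?joing_subr //= (norm_joinEl nBK) KHB trivg_quotient.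
exists h, k; split=> //.
  rewrite him kim sdprodE ?quotient_norms //.
  by rewrite -quotientMl // -(quotientMidr B (K * H)) KHS.
move=> y x yH xK; have [nyB nxB] := (subsetP nBH _ yH, subsetP nBK _ xK).
by rewrite hE // !kE ?memJ_norm // ?(subsetP nKH) // morphJ.
Qed.

End Groups.

Lemma sdprod_conj_isog_setX (gT rT aT bT : finGroupType) (T : {group rT})
    (H H0 K K0 : {group gT}) (A : {group aT}) (B : {group bT}) :
    isog_sdprod_conj T H H0 K K0 -> H0 :=: 1 -> K0 :=: 1 -> H \subset 'C(K) ->
  H \isog A -> K \isog B -> T \isog setX A B.
Proof.
move=> [_ _ _ _ [h [k [injh injk defT act]]]] H01 K01 cHK isoA isoB.
have eH0 : H0 = 1%G by apply: val_inj.
have eK0 : K0 = 1%G by apply: val_inj.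
subst H0 K0; have cent : h @* (H / 1) \subset 'C(k @* (K / 1)).
  apply/centsP=> _ /morphimP[_ _ /morphimP[y _ yH ->] ->].
  move=> _ /morphimP[_ _ /morphimP[x _ xK ->] ->].
  apply/esym/commgP/conjg_fixP; rewrite -act //.
  by congr (k (coset _ _)); apply/conjg_fixP/commgP/esym/(centsP cHK).
have dT : h @* (H / 1) \x k @* (K / 1) = T by rewrite dprodC dprodEsd.
apply: (isog_dprod dT (setX_dprod A B)).
  apply: (isog_trans _ (isog_setX1 _ _)); apply: (isog_trans _ isoA).
  rewrite isog_sym; apply: (isog_trans (quotient1_isog _)).
  by apply: sub_isog.
apply: (isog_trans _ (isog_set1X _ _)); apply: (isog_trans _ isoB).
rewrite isog_sym; apply: (isog_trans (quotient1_isog _)).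
by apply: sub_isog.
Qed.

End AbstractGroups.

(** * Structure of the quotients of S_alpha *)

Section Quotients.

Variables (F : finFieldType) (n I : nat) (al : Broot n).
Hypothesis two_neq0 : 2%:R != 0 :> F.
Hypotheses (I_gt0 : (0 < I)%N) (I_lt_n : (I < n)%N).
Hypothesis alE : val al = wt n 0 + wt n I.
Notation k := (kset al).
Notation s := (s_set n I.+1).
Notation l := (l_set n I.+1).
Notation b := (b_set n I.+1).
Notation ob := (ob_set n I.+1).
Notation kob := (kob_set n I.+1).
Notation "''P' S" := (P F S) (at level 8, format "''P' S").

Let kE : k = k_set n I := kset_eq I_gt0 I_lt_n alE.

Lemma lk_normal : 'P (l :|: k) <| 'P s.
Proof.
rewrite kE; apply: (P_normal two_neq0).
- exact: s_stable.
- exact: lk_sub_s.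
- exact: lk_stable.
Qed.

Lemma allk_normal : 'P (al |: (l :|: k)) <| 'P s.
Proof.
rewrite kE; apply: (P_normal two_neq0).
- exact: s_stable.
- exact: allk_sub_s.
- exact: allk_stable.
Qed.

Lemma k_normal : 'P k <| 'P s.
Proof.
rewrite kE; apply: (P_normal two_neq0).
- exact: s_stable.
- exact: k_sub_s.
- exact: ks_stable.
Qed.

Lemma lk_mul : ('P l * 'P k)%g = 'P (l :|: k).
Proof.
rewrite kE; apply/esym/(PU_mul two_neq0 (S' := s)).
- exact: s_stable.
- exact: k_sub_s.
- exact: (subset_trans (subsetUl _ _) (lk_sub_s I_gt0 I_lt_n)).
- exact: ks_stable.
Qed.

Lemma PlbarE : Plbar F I.+1 al = ('P (l :|: k) / 'P k)%g.
Proof. by rewrite /Plbar lk_mul. Qed.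

Lemma quotient_lk_isog_setX :
  ('P s / 'P (l :|: k) \isog setX ('P s / 'P (al |: (l :|: k))) ('P [set al]))%g.
Proof.
have ss := s_stable I_gt0 I_lt_n.
apply: (quotient_isog_setX (A := 'P (s :\ al))).
- apply: (P_normal two_neq0) => //; first exact: subD1set.
  exact: sal_stable.
- exact: allk_normal.
- exact: lk_normal.
- rewrite kE (PI two_neq0); first by rewrite salI_allk.
    exact: salD_stable.
  exact: allkD_stable.
- apply/esym; rewrite -[X in 'P X](salU_al I_gt0 I_lt_n alE) setUC.
  rewrite (PU_mul two_neq0 ss) //; last 3 first.
  + exact: subD1set.
  + by apply: subset_trans (allk_sub_s I_gt0 I_lt_n alE); rewrite subsetUl.
  + exact: sal_stable.
  rewrite normC //; apply: subset_trans (P_norm two_neq0 ss _ _).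
  + by apply: (PS two_neq0); apply: subset_trans (allk_sub_s I_gt0 I_lt_n alE); rewrite subsetUl.
  + exact: subD1set.
  + exact: sal_stable.
- rewrite kE -(PU_mul two_neq0 ss) //.
  + exact: lk_sub_s.
  + by apply: subset_trans (allk_sub_s I_gt0 I_lt_n alE); rewrite subsetUl.
  + exact: lk_stable.
rewrite kE (PI two_neq0); last 2 first.
- exact: (al_stable I_gt0 I_lt_n alE).
- exact: lkD_stable.
by rewrite alI_lk // (P_set0 n two_neq0).
Qed.

Lemma Sal_quotient_isog :
  [/\ [/\ closed_pattern s, 'P k <| Sal F n I.+1 & Plbar F I.+1 al <| Sbar F I.+1 al],
      'P (l :|: k) <| Sal F n I.+1, 'P (al |: (l :|: k)) <| Sal F n I.+1,
      Sal F n I.+1 / 'P (l :|: k) \isog Sbar F I.+1 al / Plbar F I.+1 al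
    & Sbar F I.+1 al / Plbar F I.+1 al \isog setX (Tbar F I.+1 al) (X F al)]%g.
Proof.
rewrite PlbarE; have iso : (Sbar F I.+1 al / ('P (l :|: k) / 'P k) \isog
    Sal F n I.+1 / 'P (l :|: k))%g.
  apply: third_isog; rewrite ?lk_normal ?k_normal //.
  by apply: (PS two_neq0); exact: subsetUr.
split; rewrite ?lk_normal ?allk_normal //.
- split; rewrite ?k_normal //; last by apply: quotient_normal; exact: lk_normal.
  by apply/closed_patternP; exact: s_stable.
- by rewrite isog_sym.
by rewrite -(P_set1 two_neq0); apply: (isog_trans iso); exact: quotient_lk_isog_setX.
Qed.

Lemma Tbar_isog_sdprod :
  isog_sdprod_conj (Tbar F I.+1 al) ('P b) ('P (b :&: k)) ('P ob) ('P (ob :&: k)).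
Proof.
rewrite /Tbar /TalKer /Sal kE.
have ss := s_stable I_gt0 I_lt_n.
have [Rs Rn] := (allk_sub_s I_gt0 I_lt_n alE, allk_stable I_gt0 I_lt_n alE).
have [bs obs] := (b_sub_s I_gt0 I_lt_n, ob_sub_s I_gt0 I_lt_n).
apply: quotient_sdprod_conj.
- by have := allk_normal; rewrite kE.
- exact: (PS two_neq0).
- exact: (PS two_neq0).
- apply: subset_trans (P_norm two_neq0 (S := b :|: ob) _ _ _).
  + by apply: (PS two_neq0); exact: subsetUl.
  + exact: b_ob_stable.
  + exact: subsetUr.
  + exact: ob_stable.
- rewrite (PI two_neq0); first by rewrite allkI_b.
  + exact: allkD_stable.
  + exact: b_stable.
- rewrite (PI two_neq0); first by rewrite allkI_ob // obI_k.
  + exact: allkD_stable.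
  + exact: obD_stable.
- rewrite -!(PU_mul two_neq0 ss) // (PI two_neq0); first by rewrite b_ob_allk.
  + exact: ob_allk_stable.
  + exact: b_allk_stable.
have obn := ob_stable I_gt0 I_lt_n; have bobc := b_ob_stable I_gt0 I_lt_n.
have nb : 'P b \subset 'N('P ob).
  apply: subset_trans (P_norm two_neq0 bobc _ obn); last exact: subsetUr.
  by apply: (PS two_neq0); exact: subsetUl.
rewrite -(normC nb) -(PU_mul two_neq0 bobc) ?subsetUl ?subsetUr //.
have bobs : b :|: ob \subset s by rewrite subUset bs obs.
by rewrite -(PU_mul two_neq0 ss) // -sE.
Qed.

(** Both sets are normal in their union and they are disjoint, so the commutators lie in a trivial
    intersection. *)
Lemma P_kob_cent : 'P kob \subset 'C('P ob).
Proof.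
apply: normals_TI_cents.
- apply: subset_trans (P_norm two_neq0 (S := kob :|: ob) _ _ _).
  + by apply: (PS two_neq0); exact: subsetUl.
  + exact: kobob_stable.
  + exact: subsetUr.
  + exact: ob_kob_stable.
- apply: subset_trans (P_norm two_neq0 (S := kob :|: ob) _ _ _).
  + by apply: (PS two_neq0); exact: subsetUr.
  + exact: kobob_stable.
  + exact: subsetUl.
  + exact: kob_ob_stable.
rewrite (PI two_neq0); first by rewrite kobI_ob // (P_set0 n two_neq0).
  exact: kobD_stable.
exact: obD_stable.
Qed.

Lemma kob_normal_cent :
  [/\ closed_pattern kob, normal_in kob b &
      'P kob \subset 'C('P ob / 'P (ob :&: k) | 'Q)]%g.
Proof.
split; first by apply/closed_patternP; exact: kobD_stable.
  apply/normal_inP; split; first exact: b_stable.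
    exact: kob_sub_b.
  exact: kob_stable.
rewrite sub_astabQ quotient_cents ?P_kob_cent // andbT kE obI_k // (P_set0 n two_neq0).
exact: norms1.
Qed.

End Quotients.

(** * Subgroups of P(b) and P(ob) *)

Section Embedding.

Variables (F : finFieldType) (p q : nat).
Implicit Types (f g : 'I_p.+1 -> 'I_q.+1) (A B : 'M[F]_p.+1).

Definition selmx f : 'M[F]_(p.+1, q.+1) := \matrix_(a, x) (f a == x)%:R.

Lemma selmx_mulT f : injective f -> selmx f *m (selmx f)^T = 1%:M.
Proof.
move=> finj; apply/matrixP=> a b; rewrite !mxE (bigD1 (f a)) //= !mxE eqxx mul1r.
rewrite big1 ?addr0 => [|x xa]; first by rewrite (inj_eq finj) eq_sym.
by rewrite mxE eq_sym (negPf xa) mul0r.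
Qed.

Lemma selmx_mulT0 f g : (forall a b, f a != g b) -> selmx f *m (selmx g)^T = 0.
Proof.
move=> fg; apply/matrixP=> a b; rewrite !mxE big1 // => x _; rewrite !mxE.
have [<-|_] := eqVneq (f a) x; last by rewrite mul0r.
by rewrite eq_sym (negPf (fg a b)) mulr0.
Qed.

Lemma row_selmx f a : delta_mx 0 a *m selmx f = delta_mx 0 (f a) :> 'rV_q.+1.
Proof. by rewrite -rowE; apply/rowP=> x; rewrite !mxE eqxx eq_sym. Qed.

Lemma selmx_delta f a b :
  (selmx f)^T *m delta_mx a b *m selmx f = delta_mx (f a) (f b).
Proof.
rewrite -(mul_delta_mx (0 : 'I_1)) mulmxA -mulmxA row_selmx.
by rewrite -[_ *m delta_mx a 0]trmxK trmx_mul trmxK trmx_delta row_selmx trmx_delta mul_delta_mx.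
Qed.

(** For injective f this spreads A over the rows and columns in the image of f and puts 0
    elsewhere. *)
Definition conjsel f A : 'M_q.+1 := (selmx f)^T *m A *m selmx f.

Lemma conjselD f A B : conjsel f (A + B) = conjsel f A + conjsel f B.
Proof. by rewrite /conjsel mulmxDr mulmxDl. Qed.

Lemma conjselB f A B : conjsel f (A - B) = conjsel f A - conjsel f B.
Proof. by rewrite /conjsel mulmxBr mulmxBl. Qed.

Lemma conjselZ f c A : conjsel f (c *: A) = c *: conjsel f A.
Proof. by rewrite /conjsel -scalemxAr -scalemxAl. Qed.

Lemma conjselM f A B : injective f -> conjsel f (A *m B) = conjsel f A *m conjsel f B.
Proof.
move=> finj; rewrite /conjsel -!mulmxA [selmx f *m (_^T *m _)]mulmxA selmx_mulT //.
by rewrite mul1mx.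
Qed.

Lemma conjselM0 f g A B : (forall a b, f a != g b) -> conjsel f A *m conjsel g B = 0.
Proof.
move=> fg; rewrite /conjsel -!mulmxA [selmx f *m (_^T *m _)]mulmxA selmx_mulT0 //.
by rewrite mul0mx !mulmx0.
Qed.

Lemma conjsel_tr f A : (conjsel f A)^T = conjsel f A^T.
Proof. by rewrite /conjsel !trmx_mul trmxK mulmxA. Qed.

Lemma conjselE f A a b : injective f -> conjsel f A (f a) (f b) = A a b.
Proof.
move=> finj; have : selmx f *m conjsel f A *m (selmx f)^T = A.
  by rewrite /conjsel !mulmxA selmx_mulT // mul1mx -mulmxA selmx_mulT // mulmx1.
move: (conjsel f A) => M /matrixP/(_ a b) <-; rewrite !mxE (bigD1 (f b)) //= big1.
  rewrite !mxE eqxx mulr1 addr0 (bigD1 (f a)) //= big1 ?addr0 ?mxE ?eqxx ?mul1r //.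
  by move=> x xa; rewrite mxE eq_sym (negPf xa) mul0r.
by move=> x xb; rewrite [X in _ * X]mxE [X in _ * X]mxE eq_sym (negPf xb) mulr0.
Qed.

Lemma conjsel_neq0 f A x y : conjsel f A x y != 0 ->
  exists a b, [/\ x = f a, y = f b & A a b != 0].
Proof.
rewrite {1}[A]matrix_sum_delta /conjsel mulmx_sumr mulmx_suml summxE => nz.
have [/existsP[a /existsP[b /and3P[/eqP xE /eqP yE nzA]]]|no] := boolP
  [exists a, exists b, [&& x == f a, y == f b & A a b != 0]].
  by exists a, b.
case/eqP: nz; apply: big1 => a _; rewrite mulmx_sumr mulmx_suml summxE big1 // => b _.
rewrite -scalemxAr -scalemxAl selmx_delta !mxE; apply/eqP; rewrite mulf_eq0.
apply: contraR no; rewrite negb_or => /andP[nzA].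
case: (boolP (_ && _)) => [/andP[/eqP xE /eqP yE] _|]; last by rewrite eqxx.
by apply/existsP; exists a; apply/existsP; exists b; rewrite xE yE !eqxx.
Qed.

(** Removing and restoring the identity leaves 1 on the diagonal outside the image of f, so
    invertible matrices stay invertible. *)
Definition embmx f A : 'M_q.+1 := conjsel f (A - 1%:M) + 1%:M.

Lemma embmx1 f : embmx f 1%:M = 1%:M.
Proof. by rewrite /embmx subrr /conjsel mulmx0 mul0mx add0r. Qed.

Lemma embmxM f A B : injective f -> embmx f (A *m B) = embmx f A *m embmx f B.
Proof.
move=> finj; rewrite /embmx; have -> : A *m B - 1%:M =
    (A - 1%:M) *m (B - 1%:M) + (A - 1%:M) + (B - 1%:M).
  rewrite -{1}[A](subrK 1%:M) -{1}[B](subrK 1%:M); move: (A - _) (B - _) => a b.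
  by rewrite mulmxDl mul1mx mulmxDr mulmx1 addrA addrK.
move: (A - 1%:M) (B - 1%:M) => a b; rewrite !conjselD conjselM // mulmxDl mul1mx mulmxDr mulmx1.
by rewrite !addrA.
Qed.

Variable (f : 'I_p.+1 -> 'I_q.+1).
Hypothesis finj : injective f.

Lemma embmx_unit (u : {'GL_p.+1[F]}) : embmx f (GLval u) \is a GRing.unit.
Proof.
have /mulmx1_unit[] : embmx f (GLval u) *m embmx f (GLval u^-1) = 1%:M.
  have E : GLval u *m GLval u^-1 = 1%:M by exact: (congr1 val (mulgV u)).
  by rewrite -embmxM // E embmx1.
by [].
Qed.

Definition embGL (u : {'GL_p.+1[F]}) : {'GL_q.+1[F]} := FinRing.unit _ (embmx_unit u).

Lemma embGL_morphM : {in setT &, {morph embGL : u v / (u * v)%g}}.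
Proof. by move=> u v _ _; apply: val_inj; exact: embmxM. Qed.

Canonical embGL_morphism := Morphism embGL_morphM.

Lemma embGL_inj : injective embGL.
Proof.
move=> u v /(congr1 val) /= /addIr E; apply/val_inj/matrixP=> a b /=.
have := congr1 (fun M : 'M_q.+1 => M (f a) (f b)) E.
by rewrite /= !conjselE // !mxE => /addIr.
Qed.

End Embedding.

(** * Identification of P(b) with UB_(n-2) *)

Section Deletion.

Variables (n I : nat).
Hypotheses (I_gt0 : (0 < I)%N) (I_lt_n : (I < n)%N).
Notation m := (n - 2)%N.

(* The increasing map of positions that skips 0, I, 2n - I and 2n. *)
Definition skip (a : nat) : nat := (a + 1 + (I.-1 <= a) + (m.*2 - I.-1 < a))%N.

Lemma skip_lt a c : (a < c)%N -> (skip a < skip c)%N.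
Proof. by rewrite /skip; lia. Qed.

Lemma skip_inj : injective skip.
Proof. by move=> a c; case: (ltngtP a c) => // /skip_lt; lia. Qed.

Lemma skip_mirror a : (a <= m.*2)%N -> skip (m.*2 - a) = (n.*2 - skip a)%N.
Proof. by rewrite /skip; lia. Qed.

Lemma skip_bound a : (a <= m.*2)%N -> (skip a < n.*2)%N.
Proof. by rewrite /skip; lia. Qed.

Lemma skip_mid a : (a <= m.*2)%N -> (skip a == n) = (a == m).
Proof. by rewrite /skip; lia. Qed.

Lemma skip_cls a : (a <= m.*2)%N -> cls n I (skip a) \notin [:: 0; 2; 4]%N.
Proof. by rewrite !inE !clsE // /skip; lia. Qed.

Lemma skip_lt_I a : (a <= m.*2)%N -> (skip a < I)%N = (a < I.-1)%N.
Proof. by rewrite /skip; lia. Qed.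

Lemma skip_surj x : (x < n.*2)%N -> cls n I x \notin [:: 0; 2; 4]%N ->
  exists2 a, (a <= m.*2)%N & x = skip a.
Proof.
rewrite !inE !clsE // => xn xI.
exists (x - 1 - (I < x) - (n.*2 - I < x))%N; rewrite ?/skip; lia.
Qed.

Lemma skip_posp a c : (a <= m.*2)%N -> (c <= m.*2)%N ->
  posp n (skip a) (skip c) = posp m a c.
Proof.
move=> am cm; rewrite /posp (inj_eq skip_inj); congr (_ && _).
have [lt|ge] := ltnP (a + c) m.*2.
  have : (skip a < skip (m.*2 - c))%N by apply: skip_lt; lia.
  by rewrite skip_mirror //; have := skip_bound cm; lia.
have : (skip (m.*2 - c) <= skip a)%N.
  have : (m.*2 - c <= a)%N by lia.
  by rewrite leq_eqVlt => /orP[/eqP->//|/skip_lt/ltnW].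
by rewrite skip_mirror //; have := skip_bound cm; lia.
Qed.

Variable F : finFieldType.
Hypothesis two_neq0 : 2%:R != 0 :> F.

Definition skip_ord (a : 'I_(m.*2).+1) : 'I_(n.*2).+1 := inord (skip a).

Lemma skip_ordE a : skip_ord a = skip a :> nat.
Proof. by rewrite inordK // ltnS ltnW // skip_bound // -ltnS. Qed.

Lemma skip_ord_inj : injective skip_ord.
Proof.
move=> a c /(congr1 (@nat_of_ord _)); rewrite !skip_ordE => /skip_inj E.
exact: val_inj.
Qed.

Notation phi := (embGL skip_ord_inj).

(** [skip] respects the order, the mirror and the middle position, so root vectors go to root
    vectors with the same coefficient, 2 included. *)
Lemma embmx_root_elt (r : Broot m) (r' : Broot n) a c (t : F) :
    posp m a c -> val r = wt m a + wt m c -> val r' = wt n (skip a) + wt n (skip c) ->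
  embmx skip_ord (root_elt r t) = root_elt r' t.
Proof.
wlog ac : a c / (a < c)%N => [W|] pac rE r'E.
  have [lt|lt|eq] := ltngtP a c; first exact: (W a c).
    by apply: (W c a); rewrite // 1?pospC // addrC.
  by move: pac; rewrite /posp eq eqxx.
have [am cm] := posp_le pac.
suff rvE : conjsel skip_ord (root_vector F (val r)) = root_vector F (val r').
  rewrite /embmx /root_elt [X in conjsel _ X]addrAC.
  rewrite [1%:M + t *: root_vector F (val r)]addrC addrK -addrA.
  rewrite conjselD !conjselZ conjselM ?rvE; last exact: skip_ord_inj.
  exact: addrC.
have pac' : posp n (skip a) (skip c) by rewrite skip_posp.
rewrite rE r'E !root_vectorE ?skip_lt // conjselB -!scaler_nat conjselZ.
rewrite /conjsel !selmx_delta skip_mid //.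
have skE x : (x <= m.*2)%N -> skip_ord (inord x) = inord (skip x).
  by move=> xm; apply: val_inj; rewrite /= skip_ordE !inordK // ltnS ltnW // skip_bound.
by rewrite !skE ?leq_subr // !skip_mirror.
Qed.

Lemma morphim_phi (S : {set Broot m}) (S' : {set Broot n}) :
    (forall a c, (a <= m.*2)%N -> (c <= m.*2)%N -> sr S' (skip a) (skip c) = sr S a c) ->
    (forall x y, sr S' x y ->
      (cls n I x \notin [:: 0; 2; 4]%N) && (cls n I y \notin [:: 0; 2; 4]%N)) ->
  (phi @* P F S)%g = P F S'.
Proof.
move=> SS' out; apply/eqP; rewrite eqEsubset; apply/andP; split.
  rewrite sub_morphim_pre ?subsetT //; apply: (P_sub (two_neq0 := two_neq0)) => r t rS.
  have [a [c [_ pac rE]]] := BrootP r; have [am cm] := posp_le pac.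
  have [r' r'E] := ex_root (etrans (skip_posp am cm) pac).
  rewrite mem_morphpre ?inE //=; have -> : phi (xr two_neq0 r t) = xr two_neq0 r' t.
    by apply: val_inj; exact: embmx_root_elt pac rE r'E.
  apply: mem_P; rewrite -(sr_root _ (etrans (skip_posp am cm) pac) r'E) SS' //.
  by rewrite (sr_root _ pac rE).
apply: (@P_sub _ _ two_neq0 _ (phi @* P F S)) => r' t r'S.
have [x [y [_ pxy r'E]]] := BrootP r'; have [xn yn] := posp_le pxy.
have sxy : sr S' x y by rewrite (sr_root _ pxy r'E).
have /andP[ox oy] := out _ _ sxy.
have [xlt ylt] : (x < n.*2)%N /\ (y < n.*2)%N by move: pxy; rewrite /posp; lia.
have [[a am xE] [c cm yE]] := (skip_surj xlt ox, skip_surj ylt oy); subst x y.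
have pac : posp m a c by rewrite -skip_posp.
have [r rE] := ex_root pac.
have -> : xr two_neq0 r' t = phi (xr two_neq0 r t).
  by apply: val_inj; apply/esym; exact: embmx_root_elt pac rE r'E.
apply: mem_morphim; rewrite ?inE //; apply: mem_P.
by rewrite -(sr_root _ pac rE) -SS'.
Qed.

Notation b := (b_set n I.+1).
(** Counterpart of [b :&: k] under [skip]. Below I only position 0 is deleted, hence the bound
    [I.-1]. *)
Definition k_small : {set Broot m} := pset m (fun a c => (a < I.-1) && (c < I.-1))%N.

Lemma sr_k_small a c : sr k_small a c = [&& posp m a c, a < I.-1 & c < I.-1]%N.
Proof. by rewrite sr_pset [X in _ || X]andbC orbb. Qed.

Lemma k_small_stable : add_stable k_small setT.
Proof.
move=> x y z; rewrite !sr_k_small sr_setT /posp => /and3P[_ xI yI] yz xz.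
by rewrite xz xI; move: yz; lia.
Qed.

Lemma phi_UB : (phi @* UB F m)%g = P F b.
Proof.
apply: morphim_phi => [a c am cm|x y].
  by rewrite sr_b_set // skip_posp // sr_setT /in_b !skip_cls // !andbT.
by rewrite sr_b_set // => /andP[].
Qed.

Lemma phi_k_small : (phi @* P F k_small)%g = P F (b :&: k_set n I).
Proof.
apply: morphim_phi => [a c am cm|x y].
  rewrite sr_setI sr_b_set // cls_k sr_k_small skip_posp // /in_b !skip_cls // andbT /=.
  by rewrite /in_k !cls_lt2 // !skip_lt_I //; case: posp.
by rewrite sr_setI sr_b_set // => /andP[/andP[]].
Qed.

Lemma Pb_isog_UB : (P F b \isog UB F m)%g.
Proof.
rewrite isog_sym -phi_UB; apply: sub_isog; first exact: subsetT.
by apply/injmP=> u v _ _; exact: embGL_inj.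
Qed.

Lemma Pb_quotient_isog_UB : exists2 N : {set Broot m}, normal_in N setT &
  (P F b / P F (b :&: k_set n I) \isog UB F m / P F N)%g.
Proof.
have nN : normal_in k_small setT.
  apply/normal_inP; split; [|exact: subsetT|exact: k_small_stable].
  by move=> x y z; rewrite !sr_setT.
exists k_small => //; have /normal_inP[cT sT nT] := nN.
have nP : P F k_small <| UB F m by exact: P_normal.
rewrite isog_sym /= -phi_UB -phi_k_small; apply: injm_quotient_isog => //.
  by apply/injmP=> u v _ _; exact: embGL_inj.
exact: subsetT.
Qed.
End Deletion.

Section Unitriangular.
Variables (F : finFieldType) (p : nat).

Lemma UAP (u : {'GL_p.+1[F]}) :
  reflect (supp (fun x y : 'I_p.+1 => x < y)%N (GLval u - 1%:M)) (u \in UA F p).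
Proof.
rewrite inE; apply: (iffP forallP) => [H x y|H x].
  rewrite ltnNge; apply: contra => yx.
  by have /forallP/(_ y)/implyP/(_ yx)/eqP := H x; rewrite !mxE => ->; rewrite subrr.
apply/forallP=> y; apply/implyP=> yx; rewrite -subr_eq0; apply/eqP.
have : ~~ (x < y)%N by rewrite -leqNgt.
by move=> /(supp_eq0 H); rewrite !mxE.
Qed.

Lemma UA_group_set : group_set (UA F p).
Proof.
apply/group_setP; split.
  by apply/UAP => x y; rewrite GL_1E subrr mxE eqxx.
move=> u v /UAP su /UAP sv; apply/UAP.
have -> : GLval (u * v)%g - 1%:M = GLval u *m GLval v - 1%:M by [].
rewrite mul_unip; apply: suppD; last exact: suppD.
by apply: (suppM _ su sv) => x y z; apply: ltn_trans.
Qed.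

Canonical UA_group := Group UA_group_set.

Lemma UA_inv (u : {'GL_p.+1[F]}) : u \in UA F p -> u^-1%g \in UA F p.
Proof.
by rewrite -[UA F p]/(gval UA_group) groupV.
Qed.

Lemma trinv_unit (u : {'GL_p.+1[F]}) : (GLval u^-1)^T \is a @GRing.unit 'M[F]_p.+1.
Proof. by have := GL_unitmx u^-1; rewrite -unitmx_tr. Qed.

Definition trinv (u : {'GL_p.+1[F]}) : {'GL_p.+1[F]} := FinRing.unit _ (trinv_unit u).

Lemma trinvM u v : trinv (u * v)%g = (trinv u * trinv v)%g.
Proof.
have E : GLval (u * v)^-1%g = GLval v^-1 *m GLval u^-1 by rewrite invMg.
by apply: val_inj; exact: (etrans (congr1 trmx E) (trmx_mul _ _)).
Qed.

Definition transv (a b : 'I_p.+1) (t : F) : 'M_p.+1 := 1%:M + t *: delta_mx a b.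

Lemma transvM a b s t : a != b -> transv a b s *m transv a b t = transv a b (s + t).
Proof.
move=> ab; rewrite /transv mulmxDl mul1mx mulmxDr mulmx1 -scalemxAl -scalemxAr.
rewrite mul_delta_mx_cond eq_sym (negPf ab) !scaler0 addr0 scalerDl.
by rewrite -addrA [t *: _ + _]addrC.
Qed.

Lemma transv0 a b : transv a b 0 = 1%:M.
Proof. by rewrite /transv scale0r addr0. Qed.

Lemma transv_unit a b t : a != b -> transv a b t \is a @GRing.unit 'M[F]_p.+1.
Proof.
move=> ab; have /mulmx1_unit[] : transv a b t *m transv a b (- t) = 1%:M.
  by rewrite transvM // subrr transv0.
by [].
Qed.

Definition transvGL a b (ab : a != b) t : {'GL_p.+1[F]} :=
  FinRing.unit _ (transv_unit t ab).

Lemma transvGLD a b (ab : a != b) s t :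
  transvGL ab (s + t) = (transvGL ab s * transvGL ab t)%g.
Proof. by apply: val_inj; apply/esym; exact: transvM. Qed.

Lemma transvGL0 a b (ab : a != b) : transvGL ab 0 = 1%g.
Proof. by apply: val_inj; exact: transv0. Qed.

Lemma transvGLV a b (ab : a != b) t : (transvGL ab t)^-1%g = transvGL ab (- t).
Proof. by apply/eqP; rewrite eq_invg_mul -transvGLD subrr transvGL0. Qed.

End Unitriangular.

(** * The Levi complement of P(kob) in P(b) *)

Section Levi.

Variables (F : finFieldType) (n I p : nat).
Hypothesis two_neq0 : 2%:R != 0 :> F.
Hypotheses (I_gt0 : (0 < I)%N) (I_lt_n : (I < n)%N) (pI : p.+2 = I).
Notation N := (n.*2.+1).

(** The positions 1, ..., I - 1 of class 1. There are p + 1 = i - 2 of them, which is the matrix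
    size of UA_(i-3). *)
Definition top_pos (r : 'I_p.+1) : 'I_N := inord r.+1.
Definition bot_pos (r : 'I_p.+1) : 'I_N := rev_ord (top_pos r).

Lemma top_posE r : top_pos r = r.+1 :> nat.
Proof. by rewrite inordK //; have := ltn_ord r; lia. Qed.

Lemma top_pos_inj : injective top_pos.
Proof. by move=> r s /(congr1 (@nat_of_ord _)); rewrite !top_posE => -[/val_inj]. Qed.

Lemma bot_pos_inj : injective bot_pos.
Proof. by move=> r s /rev_ord_inj/top_pos_inj. Qed.

Lemma top_bot r s : top_pos r != bot_pos s.
Proof.
by rewrite -val_eqE /= subSS !top_posE; move: (ltn_ord r) (ltn_ord s); lia.
Qed.

Lemma bot_top r s : bot_pos r != top_pos s.
Proof. by rewrite eq_sym top_bot. Qed.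

Lemma dcoef_top r : dcoef F (top_pos r) = 1.
Proof.
by rewrite /dcoef top_posE; have -> : (r.+1 == n) = false by have := ltn_ord r; lia.
Qed.

Lemma selmx_top_Gram : selmx F top_pos *m Gram F n = selmx F bot_pos.
Proof.
apply/matrixP=> r x; rewrite mul_formE !mxE.
have -> : (top_pos r == rev_ord x) = (bot_pos r == x).
  by rewrite -(inj_eq rev_ord_inj) rev_ordK.
have [<-|_] := eqVneq (bot_pos r) x; last by rewrite mul0r.
by rewrite dcoef_rev dcoef_top mulr1.
Qed.

Lemma Gram_tr : (Gram F n)^T = Gram F n.
Proof.
apply/matrixP=> x y; rewrite !mxE.
have -> : (x == rev_ord y) = (y == rev_ord x) by apply/eqP/eqP => ->; rewrite rev_ordK.
have [->|_] := eqVneq y (rev_ord x); last by rewrite !mul0r.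
by rewrite dcoef_rev.
Qed.

Lemma selmx_bot_Gram : selmx F bot_pos *m Gram F n = selmx F top_pos.
Proof.
apply/matrixP=> r x; rewrite mul_formE !mxE (inj_eq rev_ord_inj).
have [<-|_] := eqVneq (top_pos r) x; last by rewrite mul0r.
by rewrite dcoef_top mulr1.
Qed.

Lemma Gram_selmx_top : Gram F n *m (selmx F top_pos)^T = (selmx F bot_pos)^T.
Proof. by rewrite -[in LHS]Gram_tr -trmx_mul selmx_top_Gram. Qed.

Lemma Gram_selmx_bot : Gram F n *m (selmx F bot_pos)^T = (selmx F top_pos)^T.
Proof. by rewrite -[in LHS]Gram_tr -trmx_mul selmx_bot_Gram. Qed.

(* The Levi embedding GL_(I-1) -> SO_(2n+1), u |-> diag(1, u, 1, u^-T, 1). *)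
Definition levi (u : {'GL_p.+1[F]}) : {'GL_N[F]} :=
  (embGL top_pos_inj u * embGL bot_pos_inj (trinv u))%g.

Lemma levi_sub1 u : GLval (levi u) - 1%:M =
  conjsel top_pos (GLval u - 1%:M) + conjsel bot_pos ((GLval u^-1)^T - 1%:M).
Proof.
have -> : GLval (levi u) - 1%:M =
    embmx top_pos (GLval u) *m embmx bot_pos (GLval u^-1)^T - 1%:M by [].
by rewrite mul_unip !addrK conjselM0 ?add0r //; exact: top_bot.
Qed.

Lemma levi_morphM : {in setT &, {morph levi : u v / (u * v)%g}}.
Proof.
move=> u v _ _; rewrite /levi trinvM.
have com x y : (embGL top_pos_inj x * embGL bot_pos_inj y)%g =
               (embGL bot_pos_inj y * embGL top_pos_inj x)%g.
  apply: val_inj; apply: (addIr (- 1%:M : 'M_N)).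
  have -> : val (embGL top_pos_inj x * embGL bot_pos_inj y)%g =
    embmx top_pos (GLval x) *m embmx bot_pos (GLval y) by [].
  have -> : val (embGL bot_pos_inj y * embGL top_pos_inj x)%g =
    embmx bot_pos (GLval y) *m embmx top_pos (GLval x) by [].
  rewrite !mul_unip !addrK !conjselM0; [|exact: bot_top|exact: top_bot].
  by rewrite !add0r addrC.
rewrite (embGL_morphM top_pos_inj (in_setT u) (in_setT v)).
rewrite (embGL_morphM bot_pos_inj (in_setT (trinv u)) (in_setT (trinv v))).
by rewrite -!mulgA; congr (_ * _)%g; rewrite !mulgA com.
Qed.

Canonical levi_morphism := Morphism levi_morphM.

Lemma levi_inj : injective levi.
Proof.
move=> u v /(congr1 (fun x => GLval x - 1%:M)); rewrite !levi_sub1 => E.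
apply/val_inj/matrixP=> a b; have := congr1 (fun M : 'M_N => M (top_pos a) (top_pos b)) E.
have nz w : conjsel bot_pos w (top_pos a) (top_pos b) = 0 :> F.
  apply/eqP; apply: contraT => /conjsel_neq0[c [d [/eqP]]].
  by rewrite (negPf (top_bot a c)).
rewrite /= ![(_ + conjsel bot_pos _) _ _]mxE !nz !addr0 !conjselE; try exact: top_pos_inj.
by rewrite !mxE => /addIr.
Qed.

Lemma levi_orth u : (GLval (levi u))^T *m Gram F n *m GLval (levi u) = Gram F n.
Proof.
have E1 : GLval u^-1 *m GLval u - 1%:M = 0.
  by apply/eqP; rewrite subr_eq0; apply/eqP; exact: (congr1 val (mulVg u)).
have E2 : (GLval u)^T *m (GLval u^-1)^T - 1%:M = 0.
  by rewrite -trmx_mul -[1%:M]trmx1 (subr0_eq E1) subrr.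
have trB1 (A : 'M[F]_p.+1) : (A - 1%:M)^T = A^T - 1%:M.
  by apply/matrixP=> i j; rewrite !mxE eq_sym.
(* With a = u - 1 and c = u^-1 - 1, the inverse relation reads ca + c + a = 0. It and its transpose
   cancel the blocks collected in [Z1] and [Z2]. *)
rewrite mul_unip in E1; rewrite mul_unip -!trB1 in E2.
rewrite -[GLval (levi u)](subrK 1%:M) levi_sub1 -trB1.
move: (GLval u - 1%:M) (GLval u^-1 - 1%:M) E1 E2 => a c E1 E2.
have trE : (conjsel top_pos a + conjsel bot_pos c^T + 1%:M)^T =
    conjsel top_pos a^T + conjsel bot_pos c + 1%:M.
  have trD (A B : 'M[F]_N) : (A + B)^T = A^T + B^T by apply/matrixP=> x y; rewrite !mxE.
  by rewrite !trD trmx1 !conjsel_tr trmxK.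
rewrite {}trE /conjsel.
have [CD DC] := (selmx_mulT0 F top_bot, selmx_mulT0 F bot_top).
have [CC DD] := (selmx_mulT F top_pos_inj, selmx_mulT F bot_pos_inj).
have [CG DG] := (selmx_top_Gram, selmx_bot_Gram).
have [GC GD] := (Gram_selmx_top, Gram_selmx_bot).
move: (selmx F top_pos) (selmx F bot_pos) (Gram F n) CD DC CC DD CG DG GC GD.
move=> C D G CD DC CC DD CG DG GC GD.
have -> : (C^T *m a^T *m C + D^T *m c *m D + 1%:M) *m G =
    C^T *m a^T *m D + D^T *m c *m C + G.
  by rewrite !mulmxDl mul1mx -(mulmxA _ C G) CG -(mulmxA _ D G) DG.
rewrite mulmxDr mulmx1 mulmxDr !mulmxDl.
have simp1 (A B : 'M[F]_p.+1) : C^T *m A *m D *m (C^T *m B *m C) = 0.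
  by rewrite -!mulmxA [D *m (_ *m _)]mulmxA DC mul0mx !mulmx0.
have simp2 (A B : 'M[F]_p.+1) : C^T *m A *m D *m (D^T *m B *m D) = C^T *m (A *m B) *m D.
  by rewrite -!mulmxA [D *m (_ *m _)]mulmxA DD mul1mx.
have simp3 (A B : 'M[F]_p.+1) : D^T *m A *m C *m (C^T *m B *m C) = D^T *m (A *m B) *m C.
  by rewrite -!mulmxA [C *m (_ *m _)]mulmxA CC mul1mx.
have simp4 (A B : 'M[F]_p.+1) : D^T *m A *m C *m (D^T *m B *m D) = 0.
  by rewrite -!mulmxA [C *m (_ *m _)]mulmxA CD mul0mx !mulmx0.
rewrite simp1 simp2 simp3 simp4 !mulmxA GC GD add0r addr0.
have Z1 : D^T *m c *m a *m C + (D^T *m c *m C + D^T *m a *m C) = 0.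
  by rewrite -[D^T *m c *m a]mulmxA -!mulmxDl -!mulmxDr E1 mulmx0 mul0mx.
have Z2 : C^T *m a^T *m c^T *m D + (C^T *m a^T *m D + C^T *m c^T *m D) = 0.
  by rewrite -[C^T *m a^T *m c^T]mulmxA -!mulmxDl -!mulmxDr E2 mulmx0 mul0mx.
(* Terms 1, 6, 2 make up [Z1], terms 3, 5, 4 make up [Z2], and term 7 is G. *)
rewrite [LHS](AC (2*2*3) ((1*(6*2))*(3*(5*4))*7)) /=.
by rewrite Z1 Z2 !add0r.
Qed.

Definition lev_set : {set Broot n} := pset n (fun a c => in_lev (cls n I a) (cls n I c)).
Notation lev := lev_set.

Lemma cls_lev : has_cls I lev (symm in_lev).
Proof. by move=> a c; rewrite sr_pset. Qed.

Lemma top_lev r s : Nr lev (top_pos r) (top_pos s) = (r < s)%N.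
Proof.
rewrite /Nr cls_lev /symm /in_lev !clsE // !top_posE /posp.
by move: (ltn_ord r) (ltn_ord s); lia.
Qed.

Lemma bot_lev r s : Nr lev (bot_pos r) (bot_pos s) = (s < r)%N.
Proof. by rewrite Nr_mirror top_lev. Qed.

Lemma levi_supp u : u \in UA F p -> supp (Nr lev) (GLval (levi u) - 1%:M).
Proof.
move=> uU; have uVU := UA_inv uU.
move/UAP: uU => su; move/UAP: uVU => suV.
rewrite levi_sub1; apply: suppD => x y /conjsel_neq0[r [s [-> ->]]].
  by move=> /su; rewrite top_lev.
have -> : ((GLval u^-1)^T - 1%:M) r s = (GLval u^-1 - 1%:M) s r by rewrite !mxE eq_sym.
by move=> /suV; rewrite bot_lev.
Qed.

(** The root element of {x, y} is the image of the transvection at (a, b), where a and b index the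
    positions x and 2n - y. Its root vector squares to 0, so no quadratic term appears. *)
Lemma levi_xr (r : Broot n) t : r \in lev -> xr two_neq0 r t \in (levi @* UA F p)%g.
Proof.
move=> rlev; have [x [y [xy pxy rE]]] := BrootP r.
have : sr lev x y by rewrite (sr_root _ pxy rE).
rewrite cls_lev pxy /symm /in_lev !clsE //= => xyE.
have aP : (x.-1 < p.+1)%N by move: pxy xyE xy; rewrite /posp; lia.
have bP : ((n.*2 - y).-1 < p.+1)%N by move: pxy xyE xy; rewrite /posp; lia.
pose a := Ordinal aP; pose b := Ordinal bP.
have xa : inord x = top_pos a by rewrite /top_pos /= prednK //; move: xyE xy; lia.
have yb : inord (n.*2 - y) = top_pos b.
  by rewrite /top_pos /= prednK //; move: pxy xyE xy; rewrite /posp; lia.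
have ab : a != b by rewrite -val_eqE /=; move: pxy xyE xy; rewrite /posp; lia.
have [xn yn] := posp_le pxy.
have xa' : inord (n.*2 - x) = bot_pos a.
  apply: val_inj; rewrite /bot_pos /= top_posE inordK ?ltnS ?leq_subr //= prednK ?subSS //.
  by move: xyE xy; lia.
have yb' : inord y = bot_pos b.
  apply: val_inj; rewrite /bot_pos /= top_posE inordK ?ltnS //= prednK ?subSS ?subKn //.
  by move: pxy xyE xy; rewrite /posp; lia.
have rvE : root_vector F (val r) =
    conjsel top_pos (delta_mx a b) - conjsel bot_pos (delta_mx b a).
  rewrite rE root_vectorE // xa yb xa' yb' /conjsel !selmx_delta.
  by have -> : (y == n) = false by move: xyE xy; lia.
have rv2 : root_vector F (val r) *m root_vector F (val r) = 0.
  rewrite rvE mulmxBl !mulmxBr (conjselM0 _ _ top_bot) (conjselM0 _ _ bot_top).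
  rewrite -(conjselM _ _ top_pos_inj) -(conjselM _ _ bot_pos_inj) !mul_delta_mx_cond.
  rewrite [b == a]eq_sym (negPf ab) !mulr0n /conjsel !mulmx0 !mul0mx !subr0.
  by [].
have uE : GLval (transvGL ab t) = transv a b t by [].
have uVE : GLval (transvGL ab t)^-1%g = transv a b (- t) by rewrite transvGLV.
have -> : xr two_neq0 r t = levi (transvGL ab t).
  apply: val_inj; apply: (addIr (- 1%:M : 'M_N)).
  have -> : val (levi (transvGL ab t)) = GLval (levi (transvGL ab t)) by [].
  rewrite levi_sub1 uE uVE /transv.
  have -> : val (xr two_neq0 r t) = root_elt r t by [].
  rewrite /root_elt rv2 scaler0 addr0 rvE [1%:M + t *: (_ - _)]addrC addrK.
  rewrite [1%:M + t *: _]addrC addrK conjselZ scalerBr; congr (_ + _).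
  have -> : (1%:M + - t *: delta_mx a b)^T - 1%:M = - t *: delta_mx b a :> 'M[F]_p.+1.
    by apply/matrixP=> i j; rewrite !mxE [j == i]eq_sym addrAC subrr add0r andbC.
  by rewrite conjselZ scaleNr.
apply: mem_morphim; first by rewrite inE.
apply/UAP; rewrite uE /transv [1%:M + _]addrC addrK => i j; rewrite !mxE.
case: (boolP (_ && _)) => [/andP[/eqP-> /eqP->] _|_]; last by rewrite mulr0 eqxx.
by rewrite /=; move: pxy xyE xy; rewrite /posp; lia.
Qed.

(** By [levi_supp] every off-diagonal nonzero entry of an image already lies at a position of [lev],
    so [P_lowest] gives the converse of [levi_xr]. *)
Lemma levi_P : (levi @* UA F p)%g = P F lev.
Proof.
have sG : (levi @* UA F p)%g \subset patt F (@ltr n).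
  apply/subsetP=> _ /morphimP[u _ uU ->]; apply/pattP; split; first exact: levi_orth.
  by apply: supp_sub (levi_supp uU) => x y; exact: Nr_lt.
have sPG : P F lev \subset levi @* UA_group F p.
  by apply: (P_sub (two_neq0 := two_neq0)) => r t; exact: levi_xr.
apply/eqP; rewrite eqEsubset sPG andbT.
apply: (P_lowest two_neq0 sG sPG) => _ x y /morphimP[u _ uU ->] [xy nz _].
by apply: (levi_supp uU); rewrite unip_entry // -val_eqE /= ltn_eqF.
Qed.

Notation b := (b_set n I.+1).
Notation kob := (kob_set n I.+1).

Lemma lev_stable : add_stable lev lev.
Proof. by apply: cls_stableP; [| |exact: cls_lev|exact: cls_lev|by vm_compute]. Qed.

Let cls_kobI := cls_kob I_gt0 I_lt_n.
Let cls_bI := cls_b I_gt0 I_lt_n.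

Lemma levU_kob : lev :|: kob = b.
Proof.
by apply: (has_cls_eq I_gt0 I_lt_n (has_clsU cls_lev cls_kobI) cls_bI); vm_compute.
Qed.

Lemma lev_sub_b : lev \subset b.
Proof. by rewrite -levU_kob subsetUl. Qed.

Lemma kobI_lev : kob :&: lev = set0.
Proof.
apply: sr_eq => x y pxy; rewrite sr_setI cls_lev cls_kobI sr_set0 pxy /=.
by case: (symm _ _ _); rewrite ?andbF.
Qed.

Lemma UA_isog_lev : UA F p \isog P F lev.
Proof.
rewrite -levi_P; apply: (sub_isog (f := levi_morphism)); first exact: subsetT.
by apply/injmP=> u v _ _; exact: levi_inj.
Qed.

Lemma Pb_quotient_isog_UA : P F (kob :|: (k_set n I :&: b)) <| P F b /\
  (P F b / P F (kob :|: (k_set n I :&: b)) \isog UA F p)%g.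
Proof.
(* The roots of k in b lie in kob, so the denominator is P(kob). *)
rewrite kob_bk //.
have bs := b_stable I_gt0 I_lt_n; have kbs := kob_stable I_gt0 I_lt_n.
have kb := kob_sub_b I_gt0 I_lt_n.
split; first exact: (P_normal two_neq0).
have bE : P F b = (P F lev * P F kob)%g :> {set _}.
  rewrite -(PU_mul two_neq0 bs) ?levU_kob //; exact: lev_sub_b.
have nlk : P F lev \subset 'N(P F kob).
  by apply: subset_trans (P_norm two_neq0 bs kb kbs); apply: (PS two_neq0); exact: lev_sub_b.
have := second_isog nlk; rewrite (PI two_neq0 (kobD_stable I_gt0 I_lt_n) lev_stable).
rewrite kobI_lev (P_set0 n two_neq0) bE quotientMidr isog_sym => iso.
apply: (isog_trans iso); rewrite isog_sym /=.
exact: (isog_trans UA_isog_lev (quotient1_isog _)).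
Qed.

End Levi.

(** * P(ob) as a power of UA_1 *)

Section Obstruction.

Variables (F : finFieldType) (n I : nat).
Hypothesis two_neq0 : 2%:R != 0 :> F.
Hypotheses (I_gt0 : (0 < I)%N) (I_lt_n : (I < n)%N).
Notation N := (n.*2.+1).
Notation GL := {'GL_N[F]}.
Notation ob := (ob_set n I.+1).
Notation U2 := {dffun forall i : 'I_I, {'GL_2[F]}}.

Definition row_pos (r : 'I_I) : 'I_N := inord r.
Definition col_pos : 'I_N := inord I.

Lemma row_posE r : row_pos r = r :> nat.
Proof. by rewrite inordK //; move: (ltn_ord r) I_lt_n; lia. Qed.

Lemma col_posE : col_pos = I :> nat.
Proof. by rewrite inordK //; move: I_lt_n; lia. Qed.

Lemma Nr_ob x y : Nr ob x y ->
  (exists2 r, x = row_pos r & y = col_pos) \/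
  (exists2 r, x = rev_ord col_pos & y = rev_ord (row_pos r)).
Proof.
rewrite /Nr (cls_ob I_gt0 I_lt_n) /symm /in_ob !clsE // => /andP[pxy].
case/orP=> /andP[xI /eqP yE]; [left|right].
  exists (Ordinal xI); apply: ord_inj; rewrite ?row_posE ?col_posE //.
  by move: yE (ltn_ord y); move: I_lt_n; clear; lia.
exists (Ordinal xI); apply: ord_inj; rewrite rev_nat ?row_posE ?col_posE //=.
by rewrite subKn // -ltnS.
Qed.

(** A quadratic term would need an entry of g at (r, z) with r < z < I, but ob has positions only in
    column I and in its mirror row. *)
Lemma ob_entry_mul (g h : GL) r : g \in P F ob -> h \in P F ob ->
  GLval (g * h)%g (row_pos r) col_pos =
  GLval g (row_pos r) col_pos + GLval h (row_pos r) col_pos.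
Proof.
move=> gP hP; have rI : (row_pos r < col_pos)%N by rewrite row_posE col_posE ltn_ord.
have rc : row_pos r != col_pos by rewrite -val_eqE /= ltn_eqF.
have /pattP[_ sg] := subsetP (P_ltr two_neq0 ob) _ gP.
have /pattP[_ sh] := subsetP (P_ltr two_neq0 ob) _ hP.
have step (z : 'I_N) : (GLval g - 1%:M) (row_pos r) z * (GLval h - 1%:M) z col_pos = 0.
  apply/eqP; rewrite mulf_eq0; apply: contraT; rewrite negb_or => /andP[gz hz].
  have [lrz lzc] := (sg _ _ gz, sh _ _ hz); rewrite /ltr in lrz lzc.
  have rz2 : (row_pos r + z)%N != n.*2.
    by move: lrz lzc; rewrite row_posE col_posE; move: (ltn_ord r) I_lt_n; lia.
  have rz : row_pos r != z by rewrite -val_eqE /= ltn_eqF.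
  rewrite unip_entry // in gz.
  have := P_entry two_neq0 (obD_stable I_gt0 I_lt_n) gP lrz rz2 gz.
  case/Nr_ob=> [[s _ zE]|[s rE _]]; first by move: lzc; rewrite zE ltnn.
  by move: (congr1 (@nat_of_ord _) rE); rewrite rev_nat row_posE col_posE;
     move: (ltn_ord r) I_lt_n; lia.
rewrite -!unip_entry // GL_MxE mul_unip mxE [X in X + _]mxE big1 ?add0r;
  last by move=> z _; exact: step.
by rewrite mxE.
Qed.

Let o01 : (ord0 : 'I_2) != ord_max := isT.

(** Each coordinate is recorded as a transvection, so that the image is literally the product of the
    groups UA_1. *)
Definition ob_map (g : GL) : U2 :=
  [ffun r : 'I_I => transvGL o01 (GLval g (row_pos r) col_pos)].

Lemma ob_map_morphM : {in P F ob &, {morph ob_map : g h / (g * h)%g}}.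
Proof.
move=> g h gP hP; apply/ffunP=> r; rewrite mulg_ffun !ffunE ob_entry_mul //.
exact: transvGLD.
Qed.

Canonical ob_map_morphism := Morphism ob_map_morphM.

Lemma transvGL_inj (t : F) : transvGL o01 t = 1%g -> t = 0.
Proof.
move=> /(congr1 val) /matrixP/(_ ord0 ord_max) /=.
by rewrite !mxE /= mulr1 add0r.
Qed.

(** A lowest entry of an element of P(ob) lies in column I or in the mirror row. In the second case
    its mirror entry, in column I, is nonzero too, so the kernel has no lowest entry. *)
Lemma ob_map_injm : 'injm ob_map.
Proof.
apply: subset_trans (_ : P F set0 \subset _); last by rewrite (P_set0 n two_neq0).
have sK : 'ker ob_map \subset P F ob by exact: subsetIl.
apply: (P_lowest two_neq0 (subset_trans sK (P_ltr two_neq0 ob))).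
  by rewrite (P_set0 n two_neq0) sub1G.
move=> g x y gK lg; have gP := subsetP sK _ gK.
have g0 r : GLval g (row_pos r) col_pos = 0.
  have := mker gK => /ffunP/(_ r); rewrite ffunE oneg_ffun.
  exact: transvGL_inj.
have gU := subsetP (P_ltr two_neq0 ob) _ gP.
have nz := lowest_mirror_neq0 two_neq0 gU lg; have [_ gxy _] := lg.
case: (Nr_ob (P_lowest_in two_neq0 (obD_stable I_gt0 I_lt_n) gP lg)).
  by move=> [r xE yE]; case/eqP: gxy; rewrite xE yE g0.
by move=> [r xE yE]; case/eqP: nz; rewrite xE yE !rev_ordK g0.
Qed.

Lemma UA1_transv (u : {'GL_2[F]}) : (u \in UA F 1) = (u == transvGL o01 (GLval u ord0 ord_max)).
Proof.
apply/UAP/eqP => [su|->]; last first.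
  rewrite /= /transv [1%:M + _]addrC addrK => x y; rewrite !mxE.
  by case: (boolP (_ && _)) => [/andP[/eqP-> /eqP->]|]; rewrite ?mulr0 ?eqxx.
apply: val_inj => /=; apply/matrixP=> x y; rewrite !mxE.
have := supp_eq0 su (x := x) (y := y); rewrite !mxE => u0.
have [xy|xy] := boolP (x < y)%N; last first.
  have -> : (x == ord0) && (y == ord_max) = false.
    by apply/negP=> /andP[/eqP xE /eqP yE]; rewrite xE yE in xy.
  by rewrite mulr0 addr0; apply/eqP; rewrite -subr_eq0 u0.
have xE : x = ord0 by apply: val_inj; move: xy (ltn_ord y) => /=; lia.
have yE : y = ord_max by apply: val_inj; move: xy (ltn_ord y) => /=; lia.
by rewrite xE yE !eqxx mulr1 add0r.
Qed.

Lemma ob_posp (r : 'I_I) : posp n r (n.*2 - I).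
Proof. by rewrite /posp; move: (ltn_ord r) I_lt_n; lia. Qed.

Definition ob_root (r : 'I_I) : Broot n := SeqSub (posB_wt (ob_posp r)).

Lemma ob_root_in r : ob_root r \in ob.
Proof.
have rE : val (ob_root r) = wt n r + wt n (n.*2 - I) by [].
rewrite -(sr_root _ (ob_posp r) rE) (cls_ob I_gt0 I_lt_n) ob_posp /symm /in_ob !clsE //.
by rewrite ltn_ord eqxx.
Qed.

Lemma ob_entry_root r s (t : F) :
  GLval (xr two_neq0 (ob_root r) t) (row_pos s) col_pos = if s == r then t else 0.
Proof.
have lt : (r < n.*2 - I)%N by move: (ltn_ord r) I_lt_n; lia.
have rvE : root_vector F (val (ob_root r)) =
    delta_mx (row_pos r) col_pos - delta_mx (rev_ord col_pos) (rev_ord (row_pos r)).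
  rewrite (root_vectorE F lt (ob_posp r)).
  have -> : (n.*2 - I == n)%N = false by move: I_lt_n; lia.
  have E1 : inord (n.*2 - (n.*2 - I)) = col_pos by rewrite subKn //; move: I_lt_n; lia.
  have E2 : inord (n.*2 - I) = rev_ord col_pos :> 'I_N.
    apply: ord_inj; rewrite rev_nat col_posE inordK //; lia.
  have E3 : inord (n.*2 - r) = rev_ord (row_pos r) :> 'I_N.
    apply: ord_inj; rewrite rev_nat row_posE inordK //; lia.
  by rewrite E1 E2 E3.
have n1 : (col_pos == row_pos r) = false.
  by rewrite -val_eqE /= row_posE col_posE gtn_eqF.
have n2 : (col_pos == rev_ord col_pos) = false.
  by apply/eqP => /(congr1 (@nat_of_ord _)); rewrite rev_nat col_posE; move: I_lt_n; lia.
have n3 : (rev_ord (row_pos r) == row_pos r) = false.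
  apply/eqP => /(congr1 (@nat_of_ord _)); rewrite rev_nat row_posE.
  by move: (ltn_ord r) I_lt_n; lia.
have n4 : (rev_ord (row_pos r) == rev_ord col_pos) = false.
  by rewrite (inj_eq rev_ord_inj) eq_sym.
have sc : (row_pos s == col_pos) = false.
  by rewrite -val_eqE /= row_posE col_posE ltn_eqF.
have sr' : (row_pos s == rev_ord col_pos) = false.
  apply/eqP => /(congr1 (@nat_of_ord _)); rewrite rev_nat row_posE col_posE.
  by move: (ltn_ord s) I_lt_n; lia.
have rs : (row_pos s == row_pos r) = (s == r).
  by rewrite -!val_eqE /= !row_posE.
rewrite xrE /root_elt rvE mulmxBl !mulmxBr !mul_delta_mx_cond n1 n2 n3 n4 !mulr0n !subr0.
rewrite scaler0 addr0 !mxE sc sr' rs eqxx andbT /= subr0 add0r.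
by case: (s == r); rewrite ?mulr1 ?mulr0.
Qed.

Lemma ob_map_im : (ob_map @* P F ob)%g = setXn (fun _ : 'I_I => UA F 1).
Proof.
apply/eqP; rewrite eqEsubset; apply/andP; split.
  apply/subsetP=> _ /morphimP[g _ gP ->]; apply/setXnP=> r.
  by rewrite ffunE UA1_transv /= /transv !mxE /= mulr1 add0r.
apply/subsetP=> w /setXnP wU.
(* By [ob_entry_root] the r-th factor changes only coordinate r. *)
pose g := (\prod_r xr two_neq0 (ob_root r) (GLval (w r) ord0 ord_max))%g.
have xP r t : xr two_neq0 (ob_root r) t \in P F ob by apply: mem_P; exact: ob_root_in.
have gP : g \in P F ob by apply: group_prod.
suff -> : w = ob_map g by exact: mem_morphim.
rewrite /g morph_prod //; apply/ffunP=> s; rewrite prodg_ffun.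
rewrite (eq_bigr (fun r => if s == r then w s else 1%g)) => [|r _]; last first.
  rewrite ffunE ob_entry_root; case: (s =P r) => [->|_]; last exact: transvGL0.
  by have := wU r; rewrite UA1_transv => /eqP <-.
by rewrite -big_mkcond (eq_bigl (pred1 s)) ?big_pred1_eq // => r; rewrite eq_sym.
Qed.

Lemma Pob_isog : (P F ob \isog setXn (fun _ : 'I_I => UA F 1))%g.
Proof. by rewrite -ob_map_im; apply: sub_isog => //; exact: ob_map_injm. Qed.

End Obstruction.

(** Translation by 1 permutes F, so comparing the sums of all elements gives #|F| = 0 in F. If 2 = 0
    as well, oddness forces 1 = 0. *)
Lemma odd_card_two_neq0 (F : finFieldType) : odd #|F| -> 2%:R != 0 :> F.
Proof.
move=> oddF; apply/eqP=> two0; have : (1 : F) *+ #|F| = 0.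
  apply: (@addrI F (\sum_x x)); rewrite addr0 -sumr_const -big_split /=.
  by rewrite [RHS](reindex_inj (addIr 1)).
rewrite -[#|F|]odd_double_half oddF mulrnDr -mul2n mulrnA two0 mul0rn addr0.
by move/eqP; rewrite oner_eq0.
Qed.

(** * The case of i equal to 2 or 3, and the theorem *)

Section SmallI.
Variables (F : finFieldType) (n I : nat) (al : Broot n).
Hypothesis two_neq0 : 2%:R != 0 :> F.
Hypotheses (I_gt0 : (0 < I)%N) (I_lt_n : (I < n)%N).
Hypothesis alE : val al = wt n 0 + wt n I.
Notation b := (b_set n I.+1).
Notation ob := (ob_set n I.+1).
Notation kob := (kob_set n I.+1).

Lemma Tbar_isog_setX : (I <= 2)%N ->
  [/\ kob = b, kset al = nset al &
      Tbar F I.+1 al \isog setX (UB F (n - 2)) (setXn (fun _ : 'I_I => UA F 1))].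
Proof.
move=> I2; have kobE := kob_eq_b I_gt0 I_lt_n I2.
split=> //; first by rewrite (kset_eq I_gt0 I_lt_n alE) (nset_eq I_gt0 I_lt_n alE).
apply: (sdprod_conj_isog_setX (B := setXn_group (fun _ : 'I_I => UA_group F 1))
  (Tbar_isog_sdprod two_neq0 I_gt0 I_lt_n alE)).
(* For [I <= 2] every pair in k contains position 0, which b avoids. *)
- rewrite (kset_eq I_gt0 I_lt_n alE) (_ : b :&: k_set n I = set0) ?(P_set0 n two_neq0) //.
  apply: sr_eq => x y pxy; rewrite sr_setI sr_b_set // cls_k sr_set0 pxy /=.
  rewrite /in_b /in_k !inE !clsE //; move: pxy; rewrite /posp; lia.
- by rewrite (kset_eq I_gt0 I_lt_n alE) obI_k // (P_set0 n two_neq0).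
- by rewrite -kobE; exact: P_kob_cent.
- exact: Pb_isog_UB.
exact: Pob_isog.
Qed.
End SmallI.

Theorem lemma7p11 (p m : nat) (F : finFieldType) (n i : nat) (al : Broot n)
    (p_prime : prime p) (p_gt2 : (2 < p)%N) (cardF : #|F| = (p ^ m)%N)
    (n_ge2 : (2 <= n)%N) (i_gt1 : (1 < i)%N) (i_le_n : (i <= n)%N)
    (alE : val al = e n 1 + e n i) :
  let k := kset al in
  let l := l_set n i in
  let b := b_set n i in
  let ob := ob_set n i in
  let kob := kob_set n i in
  let S := Sal F n i in
  let Sb := Sbar F i al in
  let T := Tbar F i al in
  [/\ (* (a) *)
      [/\ [/\ closed_pattern (s_set n i), P F k <| S & Plbar F i al <| Sb],
          P F (l :|: k) <| S, P F (al |: (l :|: k)) <| S,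
          S / P F (l :|: k) \isog Sb / Plbar F i al
        & Sb / Plbar F i al \isog setX T (X F al)]%g,
      (* (b) *)
      isog_sdprod_conj T (P F b) (P F (b :&: k)) (P F ob) (P F (ob :&: k)),
      (* (c) *)
      (i < n)%N ->
        [/\ closed_pattern kob, normal_in kob b &
            P F kob \subset 'C(P F ob / P F (ob :&: k) | 'Q)]%g
    & [/\ (* (d) *)
      (i \in [:: 2; 3])%N ->
        [/\ kob = b, k = nset al &
            T \isog setX (UB F (n - 2)) (setXn (fun _ : 'I_(i - 1) => UA F 1))],
      (* (e) *)
      (3 < i)%N ->
        P F (b :&: k) <| P F b /\
        exists2 N : {set Broot (n - 2)}, normal_in N setT &
          (P F b / P F (b :&: k) \isog UB F (n - 2) / P F N)%g
    & (* (f) *)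
      (3 < i)%N ->
        P F (kob :|: (k :&: b)) <| P F b /\
        (P F b / P F (kob :|: (k :&: b)) \isog UA F (i - 3))%g]].
Proof.
have two_neq0 : 2%:R != 0 :> F.
  apply: odd_card_two_neq0; rewrite cardF oddX.
  by case: (even_prime p_prime) p_gt2 => [->//|->]; rewrite orbT.
(* Passage to 0-based positions: i = I + 1, and alpha is the pair {0, I}. *)
case: i i_gt1 i_le_n alE => // I i_gt1 i_le_n alE.
have alE' : val al = wt n 0 + wt n I by rewrite alE e_wtD //; lia.
have I_gt0 : (0 < I)%N by [].
split.
- exact: (Sal_quotient_isog two_neq0 I_gt0 i_le_n alE').
- exact: (Tbar_isog_sdprod two_neq0 I_gt0 i_le_n alE').
- by move=> _; apply: (kob_normal_cent two_neq0 I_gt0 i_le_n alE').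
split.
- move=> I23; have I2 : (I <= 2)%N by move: I23; rewrite !inE; lia.
  by rewrite subn1; apply: (Tbar_isog_setX two_neq0 I_gt0 i_le_n alE').
- move=> _; rewrite (kset_eq I_gt0 i_le_n alE'); split; last exact: Pb_quotient_isog_UB.
  apply: (P_normal two_neq0); [exact: b_stable | exact: subsetIl | exact: bk_stable].
move=> I3; rewrite (kset_eq I_gt0 i_le_n alE').
(* Now I = q + 2 and i - 3 = q, the parameter of the Levi embedding. *)
case: I {alE alE'} i_gt1 i_le_n I_gt0 I3 => [|[|q]] // _ i_le_n I_gt0 _.
rewrite !subSS subn0.
exact: Pb_quotient_isog_UA.
Qed.
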